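(* Let $M$ be a finite-dimensional $\langle G,\gamma\rangle$-module of dimension $m$ on which $\gamma$ acts semisimply, and suppose that $N(\Lambda^m M)=N(M)$. Then, as an identity of formal power series in the indeterminates $x,y$, $$\frac{1}{|G|}\sum_{g\in G}\frac{\det(1-yg\gamma\mid M^* )}{\det(1-xg\gamma\mid V^* )}=\frac{\prod_{\iota\in\mathcal{B}(M,\gamma)}(1-y\,\varepsilon_\iota x^{m_\iota})}{\prod_{\iota\in\mathcal{B}(\gamma)}(1-\varepsilon_\iota x^{d_\iota})}.$$
   Context: Let $K$ be an algebraically closed field of characteristic $0$, $V$ an $r$-dimensional $K$-vector space and $G\subset \mathrm{GL}(V)$ a finite group generated by (pseudo)reflections. Let $S$ be the graded algebra of polynomial functions on $V$ (the symmetric algebra of $V^*$), with $\mathrm{GL}(V)$ acting by $(gf)(v)=f(g^{-1}v)$. Let $\mathcal{H}\subset S$ be the space of $G$-harmonic polynomials (those annihilated by all $G$-invariant constant-coefficient differential operators without constant term); it is a graded complement in $S$ to the ideal generated by the homogeneous $G$-invariants of positive degree, is stable under the normaliser of $G$ in $\mathrm{GL}(V)$, and affords the regular representation of $G$. Fix a semisimple $\gamma\in\mathrm{GL}(V)$ normalising $G$. For a finite-dimensional $\langle G,\gamma\rangle$-module $M$ on which $\gamma$ acts semisimply, the space $(\mathcal{H}\otimes M^* )^G$ (graded by the degree in $\mathcal{H}$) has dimension $\dim M$; let $\mathcal{B}(M,\gamma)$ be a homogeneous basis of it consisting of $\gamma$-eigenvectors, and for $\iota\in\mathcal{B}(M,\gamma)$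 let $\varepsilon_\iota$ be its $\gamma$-eigenvalue and $m_\iota$ its degree. Write $\mathcal{B}(\gamma)=\mathcal{B}(V,\gamma)$ and $d_\iota=m_\iota+1$ for $\iota\in\mathcal{B}(\gamma)$ (the degrees of $G$). For a $G$-module $M$, $N(M)$ denotes the sum of the degrees of the elements of a homogeneous basis of $(\mathcal{H}\otimes M^* )^G$. *)

(* Defs.v *)
From HB Require Import structures.
From mathcomp Require Import all_boot all_order all_algebra.
From mathcomp.multinomials Require Import mpoly.
Set Implicit Arguments.
Unset Strict Implicit.
Unset Printing Implicit Defensive.
Import Order.TTheory GRing.Theory.
Local Open Scope ring_scope.

(* V = K^r (column vectors); S = {mpoly K[r]}, 'X_i = i-th coordinate function. *)
Section Defs.
Variables (K : fieldType) (r : nat).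
Local Notation S := {mpoly K[r]}.

Definition lin_subst (A : 'M[K]_r) : r.-tuple S :=
  [tuple \sum_(j < r) A i j *: 'X_j | i < r].

Definition pact (g : 'M[K]_r) (f : S) : S := f \mPo lin_subst (invmx g).

Definition diffop (q f : S) : S :=
  \sum_(m <- msupp q) q@_m *: mderivm m f.

(* G is given as a duplicate-free list of matrices *)
Definition invariant_op (G : seq 'M[K]_r) (q : S) : Prop :=
  forall g, g \in G -> forall f, diffop q (pact g f) = pact g (diffop q f).

Definition harmonic (G : seq 'M[K]_r) (f : S) : Prop :=
  forall q, invariant_op G q -> q@_0%MM = 0 -> diffop q f = 0.

Definition homog_of (d : nat) (f : S) : bool :=
  all (fun m => mdeg m == d) (msupp f).

Definition pseudo_reflection (A : 'M[K]_r) : bool := \rank (A - 1%:M) == 1%N.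

Definition finite_reflection_group (G : seq 'M[K]_r) : Prop :=
  [/\ uniq G, 1%:M \in G,
      forall g, g \in G -> (g \in unitmx) && (invmx g \in G),
      forall g h, g \in G -> h \in G -> g *m h \in G &
      forall g, g \in G -> exists s : seq 'M[K]_r,
        all (fun t => (t \in G) && pseudo_reflection t) s /\
        g = foldr (@mulmx K r r r) 1%:M s].

Definition in_Ggamma (G : seq 'M[K]_r) (gamma A : 'M[K]_r) : Prop :=
  exists2 g, g \in G & exists n : nat,
    A = g *m (gamma ^+ n) \/ A = g *m ((invmx gamma) ^+ n).

Definition is_rep (G : seq 'M[K]_r) (gamma : 'M[K]_r) (n : nat)
  (sigma : 'M[K]_r -> 'M[K]_n) : Prop :=
  sigma 1%:M = 1%:M /\
  forall A B, in_Ggamma G gamma A -> in_Ggamma G gamma B ->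
    sigma (A *m B) = sigma A *m sigma B.

(* top exterior power Lambda^n M, realised as the one-dimensional module det o sigma *)
Definition top_ext (n : nat) (sigma : 'M[K]_r -> 'M[K]_n) : 'M[K]_r -> 'M[K]_1 :=
  fun A => (\det (sigma A))%:M.

(* elements of S (x) M^* as row vectors of polynomials in the dual basis; action of A *)
Definition tact (n : nat) (sigma : 'M[K]_r -> 'M[K]_n) (A : 'M[K]_r)
  (F : 'rV[S]_n) : 'rV[S]_n :=
  map_mx (pact A) F *m map_mx (fun c => c%:MP) (invmx (sigma A)).

Definition in_HMG (G : seq 'M[K]_r) (n : nat) (sigma : 'M[K]_r -> 'M[K]_n)
  (F : 'rV[S]_n) : Prop :=
  (forall j, harmonic G (F 0 j)) /\ (forall g, g \in G -> tact sigma g F = F).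

Definition homog_basis (G : seq 'M[K]_r) (n : nat) (sigma : 'M[K]_r -> 'M[K]_n)
  (k : nat) (B : 'I_k -> 'rV[S]_n) (deg : 'I_k -> nat) : Prop :=
  [/\ forall i, in_HMG G sigma (B i),
      forall i j, homog_of (deg i) (B i 0 j),
      forall c : 'I_k -> K, \sum_i (c i)%:MP *: B i = 0 -> forall i, c i = 0 &
      forall F, in_HMG G sigma F -> exists c : 'I_k -> K, F = \sum_i (c i)%:MP *: B i].

Definition homog_eigenbasis (G : seq 'M[K]_r) (gamma : 'M[K]_r) (n : nat)
  (sigma : 'M[K]_r -> 'M[K]_n) (k : nat) (B : 'I_k -> 'rV[S]_n)
  (deg : 'I_k -> nat) (eps : 'I_k -> K) : Prop :=
  homog_basis G sigma B deg /\
  forall i, tact sigma gamma (B i) = (eps i)%:MP *: B i.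

Definition N_is (G : seq 'M[K]_r) (n : nat) (sigma : 'M[K]_r -> 'M[K]_n)
  (N_val : nat) : Prop :=
  exists k (B : 'I_k -> 'rV[S]_n) (deg : 'I_k -> nat),
    homog_basis G sigma B deg /\ N_val = (\sum_i deg i)%N.

End Defs.

(* rational functions in x, y: Frac(K[x][y]); x = 'X%:P, y = 'X *)
Section Series.
Variable K : fieldType.
Local Notation RF := {fraction {poly {poly K}}}.
Definition kc (c : K) : RF := tofrac (c%:P%:P).
Definition xv : RF := tofrac ('X%:P).
Definition yv : RF := tofrac 'X.
(* matrix of the contragredient action on the dual, in the dual basis *)
Definition dualmx n (A : 'M[K]_n) : 'M[K]_n := (invmx A)^T.
Definition det1m n (t : RF) (A : 'M[K]_n) : RF :=
  \det (1%:M - t *: map_mx kc (dualmx A)).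
End Series.
Arguments xv {K}.
Arguments yv {K}.

(* Main.v *)
Require Import Defs.
From HB Require Import structures.
From mathcomp Require Import all_boot all_order all_algebra perm generic_quotient ring zify.
From mathcomp.multinomials Require Import mpoly.
From Stdlib Require Import Classical_Prop IndefiniteDescription.
Set Implicit Arguments.
Unset Strict Implicit.
Unset Printing Implicit Defensive.
Import Order.TTheory GRing.Theory.
Local Open Scope ring_scope.

(* Transposing turns G into a reflection group W acting on S, and the apolar pairing
   <q, f> = (q(d) f)(0) makes the action of gamma^T on N = (S (x) M^* )^W adjoint to that of
   gamma; the harmonic polynomials of G are the orthogonal of the ideal generated by the
   W-invariants of positive degree. Hence a homogeneous eigenbasis of harmonic equivariants
   dualizes to a homogeneous basis of N over R = S^W (N is free by Chevalley's lemma), on which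
   gamma^T acts, modulo R_+ N, with the same degrees and eigenvalues.

   Let Phi be the matrix of this basis, so that gamma(Phi) = C Phi rho(gamma) with C graded
   triangular. Evaluating the Molien series at x = 1 to second order shows that Phi is square
   and computes the degree of det Phi. The hypothesis N(Lambda^m M) = N(M) then says that
   det Phi generates the det-semi-invariants, and the cyclicity of the trace applied to the
   expansion of det(A(Phi) - y C Phi) gives
     sum_g det(1 - y g gamma | M^* ) / det(1 - x g gamma | V^* )
       = prod_i (1 - y eps_i x^m_i) * sum_g 1 / det(1 - x g gamma | V^* ).
   The order-two expansion at x = 1 also gives N(Lambda^r V) = N(V); for M = V and y = x the
   left-hand side is |G|, which evaluates the remaining sum. *)

(** In coordinates both are [{mpoly K[r]}], and the chain rule makes symbols transform by the
    transposed matrix; this is the origin of the transposes. The determinant argument needs a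
    division: the sums over the group that it produces are det-semi-invariants and must be multiples
    of det Phi. Both det Phi and the generator of the semi-invariants are homogeneous, so equality
    of their degrees makes them proportional. At x = 1 the order of the pole of a Molien term is the
    multiplicity of the eigenvalue 1. Hence the leading coefficient sees only the identity and gives
    the rank, while the next one sees only elements with at most one eigenvalue l different from 1,
    for which trace - r = l - 1 = det - 1. Series in x are handled as polynomials: everything is
    multiplied by the product of all the denominators and compared modulo every power of x. Traces
    take values in K, so y is first a scalar; it becomes an indeterminate by evaluation at
    infinitely many integers. *)

(** * Linear substitutions of polynomials and homogeneous components *)

Section Substitution.
Variables (K : fieldType) (r : nat).
Local Notation S := {mpoly K[r]}.
Implicit Types (A B g h : 'M[K]_r) (p q f : S).

Lemma mpoly_ind_alg (P : S -> Prop) :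
    (forall c, P c%:MP) -> (forall i, P 'X_i) ->
    (forall p q, P p -> P q -> P (p + q)) ->
    (forall p q, P p -> P q -> P (p * q)) -> forall p, P p.
Proof.
move=> PC PX PD PM; have PXm m : P 'X_[m].
  rewrite mpolyXE_id; elim/big_ind: _ => [||i _]; [exact: (PC 1)|exact: PM|].
  by elim: (m i) => [|n IHn]; [exact: (PC 1)|rewrite exprS; exact: PM].
move=> p; rewrite (mpolyE p); elim/big_ind: _ => [||m _]; [exact: (PC 0)|exact: PD|].
by rewrite -mul_mpolyC; apply: PM.
Qed.

(** The action [pact g] is [subst (invmx g)]; the trace formula and the chain rule hold for any
    matrix [B], invertible or not, and are proved in that form. *)
Definition subst B (f : S) : S := f \mPo lin_subst B.

HB.instance Definition _ B :=
  GRing.LRMorphism.copy (subst B) (comp_mpoly (lin_subst B)).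

Lemma substC B c : subst B c%:MP = c%:MP.
Proof. exact: comp_mpolyC. Qed.

Lemma subst_add B p q : subst B (p + q) = subst B p + subst B q.
Proof. exact: raddfD. Qed.
Lemma subst_mul B p q : subst B (p * q) = subst B p * subst B q.
Proof. exact: rmorphM. Qed.

Lemma substX B i : subst B 'X_i = \sum_j B i j *: 'X_j.
Proof. by rewrite /subst comp_mpolyXU -tnth_nth tnth_mktuple. Qed.

Lemma subst_comp A B f : subst A (subst B f) = subst (B *m A) f.
Proof.
elim/mpoly_ind_alg: f => [c|i|p q IHp IHq|p q IHp IHq].
- by rewrite !substC.
- rewrite !substX linear_sum /=.
  under eq_bigr do rewrite linearZ /= substX scaler_sumr.
  rewrite exchange_big /=; apply: eq_bigr => j _.
  by rewrite mxE scaler_suml; apply: eq_bigr => k _; rewrite scalerA.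
- by rewrite !raddfD /= IHp IHq.
- by rewrite !rmorphM /= IHp IHq.
Qed.

Lemma subst1 f : subst 1%:M f = f.
Proof.
elim/mpoly_ind_alg: f => [c|i|p q IHp IHq|p q IHp IHq].
- by rewrite !substC.
- rewrite substX (bigD1 i) //= mxE eqxx scale1r big1 ?addr0 // => j ji.
  by rewrite mxE eq_sym (negPf ji) scale0r.
- by rewrite raddfD /= IHp IHq.
- by rewrite rmorphM /= IHp IHq.
Qed.

Lemma subst_homog B d f : f \is d.-homog -> subst B f \is d.-homog.
Proof.
have XB i : subst B 'X_i \is 1.-homog.
  rewrite substX; apply: rpred_sum => j _; apply: rpredZ.
  by rewrite dhomogX /= mdeg1.
have XmB m : subst B 'X_[m] \is (mdeg m).-homog.
  rewrite mpolyXE_id mdegE rmorph_prod; elim/big_rec2: _ => [|i n p _ IH].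
    by rewrite dhomog1.
  rewrite rmorphXn; apply: dhomogM IH.
  by have := dhomogMn (m i) (XB i); rewrite mul1n.
move=> /dhomogP fh; rewrite (mpolyE f) linear_sum /= big_seq.
by apply: rpred_sum => m /fh <-; rewrite linearZ /=; apply: rpredZ.
Qed.

Lemma pactE g f : pact g f = subst (invmx g) f.
Proof. by []. Qed.

HB.instance Definition _ g :=
  GRing.LRMorphism.copy (pact g) (comp_mpoly (lin_subst (invmx g))).

Lemma pactC g c : pact g c%:MP = c%:MP.
Proof. exact: substC. Qed.

Lemma pact_zero g : pact g 0 = 0. Proof. exact: raddf0. Qed.
Lemma pact_add g p q : pact g (p + q) = pact g p + pact g q.
Proof. exact: raddfD. Qed.
Lemma pact_mul g p q : pact g (p * q) = pact g p * pact g q.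
Proof. exact: rmorphM. Qed.
Lemma pact_scale g c p : pact g (c *: p) = c *: pact g p.
Proof. exact: linearZ. Qed.
Lemma pact_sum g I (s : seq I) (P : pred I) (F : I -> S) :
  pact g (\sum_(i <- s | P i) F i) = \sum_(i <- s | P i) pact g (F i).
Proof. exact: raddf_sum. Qed.

Lemma pact1 f : pact 1%:M f = f.
Proof. by rewrite pactE invmx1 subst1. Qed.

Lemma invmxM g h : g \in unitmx -> h \in unitmx ->
  invmx (g *m h) = invmx h *m invmx g.
Proof.
move=> ug uh; have ugh : g *m h \in unitmx by rewrite unitmx_mul ug.
apply: (can_inj (mulmxK ugh)); rewrite mulVmx // mulmxA -(mulmxA (invmx h)).
by rewrite mulVmx // mulmx1 mulVmx.
Qed.

Lemma pactM g h f : g \in unitmx -> h \in unitmx ->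
  pact (g *m h) f = pact g (pact h f).
Proof. by move=> ug uh; rewrite !pactE subst_comp (invmxM ug uh). Qed.

Lemma pact_homog g d f : f \is d.-homog -> pact g f \is d.-homog.
Proof. exact: subst_homog. Qed.

Lemma pactK g : g \in unitmx -> cancel (pact g) (pact (invmx g)).
Proof.
by move=> ug f; rewrite -pactM ?unitmx_inv // mulVmx // pact1.
Qed.

Lemma pact_eq0 g f : g \in unitmx -> (pact g f == 0) = (f == 0).
Proof.
move=> /pactK gK; apply/eqP/eqP => [h|->]; last exact: raddf0.
by rewrite -(gK f) h raddf0.
Qed.

Lemma mpoly_ind_lin (P : S -> Prop) :
    (forall m, P 'X_[m]) -> (forall c p, P p -> P (c *: p)) ->
    (forall p q, P p -> P q -> P (p + q)) -> forall p, P p.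
Proof.
move=> PX PZ PD p; rewrite (mpolyE p); elim/big_ind: _ => [||m _].
- by rewrite -(scale0r 'X_[0]); apply: PZ.
- exact: PD.
- exact: PZ.
Qed.

(** Together with [pihomog_mulr_lt], this extracts one homogeneous component of a relation between
    homogeneous vectors. Two cases are needed because subtraction of degrees is truncated. *)
Lemma pihomog_mulr d e f p : f \is e.-homog ->
  pihomog mdeg (d + e) (p * f) = pihomog mdeg d p * f.
Proof.
move=> fe; elim/mpoly_ind_lin: p => [m|c p IH|p q IHp IHq].
- have Xf : 'X_[m] * f \is (mdeg m + e).-homog.
    by apply: dhomogM => //; rewrite dhomogX.
  rewrite pihomogX /=; case: eqP => [<-|md]; first by rewrite pihomog_dE.
  by rewrite mul0r (pihomog_ne0 _ Xf) // eqn_add2r; apply/eqP.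
- by rewrite -scalerAl !linearZ /= IH scalerAl.
- by rewrite mulrDl !linearD /= IHp IHq mulrDl.
Qed.

Lemma pihomog_mulr_lt d e f p : f \is e.-homog -> (d < e)%N ->
  pihomog mdeg d (p * f) = 0.
Proof.
move=> fe de; elim/mpoly_ind_lin: p => [m|c p IH|p q IHp IHq].
- rewrite (@pihomog_ne0 _ _ _ (mdeg m + e)%N) ?gtn_eqF ?ltn_addl //.
  by apply: dhomogM => //; rewrite dhomogX.
- by rewrite -scalerAl linearZ /= IH scaler0.
- by rewrite mulrDl linearD /= IHp IHq addr0.
Qed.

Lemma mcoeff_pihomog d p m :
  (pihomog mdeg d p)@_m = if mdeg m == d then p@_m else 0.
Proof.
elim/mpoly_ind_lin: p => [n|c p IH|p q IHp IHq].
- rewrite pihomogX /=; case: (eqVneq n m) => [->|nm]; last first.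
    by case: ifP; rewrite ?mcoeffX ?(negPf nm) ?mcoeff0 ?if_same.
  by case: eqP; rewrite ?mcoeffX ?mcoeff0.
- by rewrite linearZ /= !mcoeffZ IH; case: eqP; rewrite ?mulr0.
- by rewrite linearD /= !mcoeffD IHp IHq; case: eqP; rewrite ?addr0.
Qed.

Lemma pihomog_mul d p q :
  pihomog mdeg d (p * q) = \sum_(e < d.+1) pihomog mdeg e p * pihomog mdeg (d - e) q.
Proof.
elim/mpoly_ind_lin: p => [n|c p IH|p1 p2 IH1 IH2].
- have Xh : 'X_[K, n] \is (mdeg n).-homog by rewrite dhomogX.
  rewrite mulrC; have [le|lt] := leqP (mdeg n) d; last first.
    rewrite (pihomog_mulr_lt _ Xh lt) big1 // => e _.
    by rewrite pihomogX /= gtn_eqF ?mul0r // (leq_trans _ lt).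
  have := pihomog_mulr (d - mdeg n) q Xh; rewrite subnK // => ->.
  have nd : (mdeg n < d.+1)%N by rewrite ltnS.
  rewrite (bigD1 (Ordinal nd)) //= big1 ?addr0 => [|e en].
    by rewrite mulrC pihomogX eqxx.
  rewrite pihomogX /=; case: eqP => [ne|]; last by rewrite mul0r.
  by case/eqP: en; apply: val_inj.
- rewrite -scalerAl linearZ /= IH scaler_sumr; apply: eq_bigr => e _.
  by rewrite linearZ /= scalerAl.
- rewrite mulrDl linearD /= IH1 IH2 -big_split; apply: eq_bigr => e _ /=.
  by rewrite linearD /= mulrDl.
Qed.

Lemma homog_eq_pihomog p q : (forall d, pihomog mdeg d p = pihomog mdeg d q) -> p = q.
Proof.
move=> e; apply/mpolyP => m; have := congr1 (mcoeff m) (e (mdeg m)).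
by rewrite !mcoeff_pihomog eqxx.
Qed.

Lemma pihomog_subst B d f : pihomog mdeg d (subst B f) = subst B (pihomog mdeg d f).
Proof.
elim/mpoly_ind_lin: f => [m|c p IH|p q IHp IHq].
- have Xh : subst B 'X_[m] \is (mdeg m).-homog by apply: subst_homog; rewrite dhomogX.
  rewrite pihomogX /=; case: eqP => [<-|md]; first by rewrite pihomog_dE.
  by rewrite raddf0 (pihomog_ne0 _ Xh) //; apply/eqP.
- by rewrite !linearZ /= IH.
- by rewrite !linearD /= IHp IHq.
Qed.

Lemma homog0C f : f \is 0.-homog -> f = (f@_0%MM)%:MP.
Proof.
move=> /dhomogP fh; apply/mpolyP => m; rewrite mcoeffC.
case: (eqVneq m 0%MM) => [->|m0]; first by rewrite mulr1.
rewrite mulr0; apply: memN_msupp_eq0; apply/negP => /fh /eqP.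
by rewrite mdeg_eq0 (negPf m0).
Qed.

Lemma homog_mcoeff0 d f : f \is d.-homog -> (0 < d)%N -> f@_0%MM = 0.
Proof. by move=> fh d0; apply: (dhomog_nemf_coeff fh); rewrite /= mdeg0 ltn_eqF. Qed.

End Substitution.

(** * Congruence of polynomials modulo a power of the indeterminate *)

Section TruncatedSeries.
Variable K : idomainType.
Implicit Types (b : nat) (p q u v : {poly K}).

Definition eqm b p q := forall i, (i < b)%N -> p`_i = q`_i.

Lemma eqm_refl b p : eqm b p p. Proof. by []. Qed.
Lemma eqm_sym b p q : eqm b p q -> eqm b q p.
Proof. by move=> pq i ib; rewrite pq. Qed.
Lemma eqm_trans b p q u : eqm b p q -> eqm b q u -> eqm b p u.
Proof. by move=> pq qu i ib; rewrite pq ?qu. Qed.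

Lemma eqmD b p q u v : eqm b p q -> eqm b u v -> eqm b (p + u) (q + v).
Proof. by move=> pq uv i ib; rewrite !coefD pq ?uv. Qed.

Lemma eqmM b p q u v : eqm b p q -> eqm b u v -> eqm b (p * u) (q * v).
Proof.
move=> pq uv i ib; rewrite !coefM; apply: eq_bigr => j _.
by rewrite pq ?uv // (leq_ltn_trans _ ib) ?leq_subr // -ltnS.
Qed.

Lemma eqm_sum b I (s : seq I) (P : pred I) (F G : I -> {poly K}) :
  (forall i, P i -> eqm b (F i) (G i)) ->
  eqm b (\sum_(i <- s | P i) F i) (\sum_(i <- s | P i) G i).
Proof.
move=> FG; elim/big_rec2: _ => [|i p q Pi pq]; first exact: eqm_refl.
by apply: eqmD pq; apply: FG.
Qed.

Lemma eqm_all p q : (forall b, eqm b p q) -> p = q.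
Proof. by move=> pq; apply/polyP => i; apply: (pq i.+1). Qed.

End TruncatedSeries.

(** * Jacobi's formula for the derivative of a determinant *)

Section JacobiFormula.
Variables (K : comNzRingType).

Lemma deriv_prod (I : finType) (F : I -> {poly K}) :
  (\prod_i F i)^`() = \sum_i (F i)^`() * \prod_(j | j != i) F j.
Proof.
have gen (s : seq I) : uniq s ->
    (\prod_(i <- s) F i)^`() =
    \sum_(i <- s) (F i)^`() * \prod_(j <- s | j != i) F j.
  elim: s => [|x s IH] /=; first by rewrite !big_nil derivC.
  case/andP=> xs us; rewrite !big_cons derivM IH // eqxx /=.
  have notx j : j \in s -> j != x by apply: contraTneq => ->.
  congr (_ * _ + _).
    rewrite big_seq [RHS]big_seq_cond; apply: eq_bigl => j.
    by case js: (j \in s) => //=; rewrite notx.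
  rewrite mulr_sumr; rewrite big_seq [RHS]big_seq; apply: eq_bigr => i /notx ix.
  by rewrite big_cons eq_sym ix mulrCA.
by rewrite gen ?index_enum_uniq.
Qed.

Lemma deriv_det n (M : 'M[{poly K}]_n) :
  (\det M)^`() = \tr (\adj M *m map_mx (@deriv K) M).
Proof.
rewrite /mxtrace.
transitivity (\sum_i \det (\matrix_(k, l) (if k == i then (M k l)^`() else M k l))).
  rewrite /determinant exchange_big /= raddf_sum /=; apply: eq_bigr => s _.
  have -> : forall (b : bool) (p : {poly K}),
    ((-1) ^+ b * p)^`() = (-1) ^+ b * p^`().
    by case=> p; rewrite ?expr0 ?expr1 ?mul1r ?mulN1r ?derivN.
  rewrite deriv_prod mulr_sumr; apply: eq_bigr => i _; congr (_ * _).
  rewrite [RHS](bigD1 i) //= mxE eqxx; congr (_ * _).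
  by apply: eq_bigr => k ki; rewrite mxE (negPf ki).
rewrite [RHS](eq_bigr (fun i => \sum_j \adj M i j * (M j i)^`())); last first.
  by move=> i _; rewrite mxE; apply: eq_bigr => j _; rewrite [map_mx _ _ _ _]mxE.
(* Expand along the differentiated row [i]: the other rows are untouched, so the cofactors are those
   of [M]. *)
rewrite [RHS]exchange_big /=; apply: eq_bigr => i _.
rewrite (expand_det_row _ i); apply: eq_bigr => j _.
rewrite !mxE eqxx mulrC; congr (_ * _); rewrite /cofactor; congr (_ * \det _).
by apply/matrixP => k l; rewrite !mxE eq_sym (negPf (neq_lift _ _)).
Qed.

End JacobiFormula.

(** * Traces on the homogeneous components of S *)

Section GradedTrace.
Variables (K : fieldType) (r : nat).
Local Notation S := {mpoly K[r]}.
Implicit Types (d e : nat) (f p q : S) (O U W : S -> S).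

Lemma homog_expand d f : f \is d.-homog ->
  f = \sum_(m : 'X_{1..r < d.+1} | mdeg m == d) f@_m *: 'X_[m].
Proof.
move=> fd; rewrite -{1}(pihomog_dE fd) (pihomogwE _ _ (k := d.+1)) //.
have /dhomogP fd' := fd; rewrite msizeE; apply/bigmax_leqP_seq => m /fd' /= ->.
by [].
Qed.

Definition gtr d O : K := \sum_(m : 'X_{1..r < d.+1} | mdeg m == d) (O 'X_[m])@_m.

Lemma eq_gtr d O O' : (forall f, f \is d.-homog -> O f = O' f) -> gtr d O = gtr d O'.
Proof. by move=> OO'; apply: eq_bigr => m /eqP md; rewrite OO' // dhomogX /= md. Qed.

Lemma gtr_sum d I (s : seq I) (P : pred I) (F : I -> S -> S) :
  gtr d (fun f => \sum_(i <- s | P i) F i f) = \sum_(i <- s | P i) gtr d (F i).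
Proof.
by rewrite /gtr exchange_big /=; apply: eq_bigr => m _; rewrite linear_sum.
Qed.

Lemma gtrZ d c O : gtr d (fun f => c *: O f) = c * gtr d O.
Proof. by rewrite /gtr mulr_sumr; apply: eq_bigr => m _; rewrite mcoeffZ. Qed.

Lemma gtrD d O O' : gtr d (fun f => O f + O' f) = gtr d O + gtr d O'.
Proof. by rewrite /gtr -big_split; apply: eq_bigr => m _; rewrite mcoeffD. Qed.

Lemma linear_expand U d f : linear U -> f \is d.-homog ->
  U f = \sum_(m : 'X_{1..r < d.+1} | mdeg m == d) f@_m *: U 'X_[m].
Proof.
move=> linU fd; pose mU := GRing.isLinear.Build _ _ _ _ U linU.
pose U' : {linear S -> S} := HB.pack U mU.
rewrite -[U]/(U' : S -> S) {1}(homog_expand fd) linear_sum.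
by apply: eq_bigr => m _; rewrite linearZ.
Qed.

(** The two traces are taken on components of different degrees. This change of degree is what later
    produces the powers of x attached to the basis vectors. *)
Lemma gtr_cyclic d e U W : linear U -> linear W ->
    (forall f, f \is d.-homog -> W f \is e.-homog) ->
    (forall f, f \is e.-homog -> U f \is d.-homog) ->
  gtr d (fun f => U (W f)) = gtr e (fun f => W (U f)).
Proof.
move=> linU linW hW hU.
transitivity (\sum_(m : 'X_{1..r < d.+1} | mdeg m == d)
   \sum_(n : 'X_{1..r < e.+1} | mdeg n == e) (W 'X_[m])@_n * (U 'X_[n])@_m).
  apply: eq_bigr => m /eqP md; have Xd : 'X_[K, m] \is d.-homog by rewrite dhomogX /= md.
  rewrite (linear_expand linU (hW _ Xd)) linear_sum /=.
  by apply: eq_bigr => n _; rewrite mcoeffZ.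
rewrite exchange_big /=; apply: eq_bigr => n /eqP ne.
have Xe : 'X_[K, n] \is e.-homog by rewrite dhomogX /= ne.
rewrite (linear_expand linW (hU _ Xe)) linear_sum /=.
by apply: eq_bigr => m _; rewrite mcoeffZ mulrC.
Qed.

Lemma mcoeff_XM_mderiv i p (m : 'X_{1..r}) :
  ('X_i * p^`M(i))@_m = (m i)%:R * p@_m.
Proof.
elim/mpoly_ind_lin: p => [n|c p IH|p q IHp IHq].
- rewrite mderivX -scalerAr mcoeffZ -mpolyXD mcoeffX.
  case ni: (n i) => [|k].
    by rewrite mul0r; case: eqP => [<-|]; rewrite ?ni ?mul0r ?mulr0.
  rewrite addmC submK ?lep1mP ?ni //.
  by rewrite mcoeffX; case: eqP => [<-|_]; rewrite ?ni ?mulr0.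
- by rewrite linearZ /= -scalerAr !mcoeffZ IH mulrCA.
- by rewrite linearD /= mulrDr !mcoeffD IHp IHq mulrDr.
Qed.

Definition gtr_poly b O : {poly K} := \poly_(d < b) gtr d O.

(* For fixed B, the graded traces of X_j d_i B satisfy a linear recursion, which
   amounts to (1 - xB) Theta = x h B for their generating matrix Theta; the trace
   of Theta is x h' by Euler's identity, and (det(1 - xB))' = - tr(adj(1 - xB) B)
   by Jacobi's, so (h det(1 - xB))' = 0. *)
Lemma gtr_subst (charK : [pchar K] =i pred0) b (B : 'M[K]_r) : (0 < b)%N ->
  eqm b (gtr_poly b (subst B) * \det (1%:M - 'X *: map_mx polyC B)) 1.
Proof.
move=> b0; set h := gtr_poly b _; set M := 1%:M - _.
pose T d j i := gtr d (fun f => 'X_j * (subst B f)^`M(i)).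
have T0 j i : T 0%N j i = 0.
  rewrite /T /gtr big1 // => m; rewrite mdeg_eq0 => /eqP ->.
  by rewrite mpolyX0 rmorph1 -mpolyC1 mderivC mulr0 mcoeff0.
(* Cyclicity replaces X_j d_i B in degree d+1 by d_i B X_j in degree d. Since B sends X_j to the sum
   of the B_jk X_k, the Leibniz rule gives the two terms. *)
have TS d j i : T d.+1 j i = B j i * gtr d (subst B) + \sum_k B j k * T d k i.
  have lin1 : linear (fun f : S => 'X_j * f) by move=> c p q; rewrite mulrDr scalerAr.
  have lin2 : linear (fun f : S => (subst B f)^`M(i)) by move=> c p q; rewrite !linearP.
  rewrite /T (gtr_cyclic (e := d) lin1 lin2) => [|f fd|f fd]; first last.
  - by rewrite -[d.+1]add1n; apply: dhomogM fd; rewrite dhomogX /= mdeg1.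
  - have /dhomogP hf := subst_homog B fd; apply/dhomogP => m.
    rewrite mcoeff_msupp mcoeff_mderiv => nz; have : (m + U_(i))%MM \in msupp (subst B f).
      by rewrite mcoeff_msupp; apply: contraNneq nz => ->; rewrite mul0rn.
    by move/hf; rewrite /= mdegD mdeg1 addn1 => -[].
  rewrite (eq_gtr (O' := fun f => B j i *: subst B f +
             \sum_k B j k *: ('X_k * (subst B f)^`M(i)))) => [|f _].
    by rewrite gtrD gtrZ gtr_sum; congr (_ + _); apply: eq_bigr => k _; rewrite gtrZ.
  rewrite rmorphM /= substX mulr_suml linear_sum /=.
  under eq_bigr do rewrite -scalerAl linearZ /= mderivM scalerDr.
  rewrite big_split /=; congr (_ + _).
  rewrite (bigD1 i) //= big1 ?addr0 => [|k ki].
    by rewrite mderivX mnm1E eqxx scale1r -{1}[U_(i)%MM]add0m addmK mpolyX0 mul1r.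
  by rewrite mderivX mnm1E (negPf ki) scale0r mul0r scaler0.
have Teuler d : \sum_i T d i i = d%:R * gtr d (subst B).
  rewrite /T -gtr_sum -gtrZ; apply: eq_bigr => m /eqP md.
  have -> : d%:R = \sum_i (m i)%:R :> K by rewrite -natr_sum -mdegE md.
  by rewrite mcoeffZ mulr_suml linear_sum; apply: eq_bigr => i _ /=; rewrite mcoeff_XM_mderiv.
pose Th : 'M[{poly K}]_r := \matrix_(j, i) \poly_(d < b) T d j i.
have ThE j i : eqm b ((M *m Th) j i) ((('X * h) *: map_mx polyC B) j i).
  move=> n nb; have coefTh k d : (d < b)%N -> (Th k i)`_d = T d k i.
    by move=> db; rewrite mxE coef_poly db.
  have -> : (M *m Th) j i = Th j i - 'X * \sum_k (B j k)%:P * Th k i.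
    rewrite mulmxBl mul1mx -scalemxAl !mxE; congr (_ - _ * _).
    by apply: eq_bigr => k _; rewrite mxE.
  rewrite coefB coefTh // !coefXM.
  have -> : (('X * h) *: map_mx polyC B) j i = 'X * (h * (B j i)%:P) by rewrite !mxE mulrA.
  rewrite coefXM.
  case: n nb => [|n] nb /=; first by rewrite subr0 T0.
  rewrite TS coef_sum coefMC coef_poly ltnW //.
  apply/eqP; rewrite subr_eq mulrC; apply/eqP; congr (_ + _).
  apply: eq_bigr => k _.
  by rewrite coefCM coefTh // ltnW.
have Dh : eqm b (\det M * ('X * h^`())) (('X * h) * - (\det M)^`()).
  have trTh : eqm b (\tr Th) ('X * h^`()).
    move=> n nb; rewrite coefXM coef_deriv /mxtrace coef_sum.
    under eq_bigr do rewrite mxE coef_poly nb.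
    case: n nb => [|n] nb /=; first by rewrite big1 // => i _; rewrite T0.
    by rewrite Teuler coef_poly nb mulr_natl.
  have -> : \det M * ('X * h^`()) = ('X * h^`()) * \det M by rewrite mulrC.
  apply: eqm_trans (eqmM (eqm_sym trTh) (@eqm_refl _ _ _)) _.
  rewrite mulrC -mxtraceZ -mul_scalar_mx -mul_adj_mx -mulmxA.
  rewrite deriv_det; have -> : map_mx (@deriv K) M = - map_mx polyC B.
    apply/matrixP => i j; rewrite !mxE derivB derivM derivX derivC mulr0 addr0 mul1r.
    by rewrite -polyC_natr derivC sub0r.
  rewrite mulmxN raddfN /= opprK -mxtraceZ scalemxAr.
  rewrite /mxtrace; apply: eqm_sum => i _; rewrite [X in eqm _ X]mxE [X in eqm _ _ X]mxE.
  by apply: eqm_sum => k _; apply: eqmM (@eqm_refl _ _ _) (ThE _ _).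
(* The derivative multiplies the coefficient of index n by n, which can be cancelled in
   characteristic 0. *)
have hD n : (0 < n < b)%N -> (h * \det M)`_n = 0.
  case: n => // n /= nb.
  have /eqP : ('X * (h * \det M)^`())`_n.+1 = 0.
    have -> : 'X * (h * \det M)^`() = \det M * ('X * h^`()) - ('X * h) * - (\det M)^`().
      by rewrite derivM mulrDr mulrN opprK mulrA [_ * \det M]mulrC mulrA.
    by rewrite coefB (Dh _ nb) subrr.
  rewrite coefXM coef_deriv /= -mulr_natr mulf_eq0 => /orP[/eqP//|].
  by rewrite (pcharf0P K).1.
case=> [|n] nb; last by rewrite coef1 hD.
rewrite coef1 coefM big_ord1 /h coef_poly b0 /=.
have -> : gtr 0 (subst B) = 1.
  rewrite /gtr (bigD1 (bm0 : 'X_{1..r < 1})) /= ?mdeg0 // mpolyX0 rmorph1 mcoeff1 eqxx.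
  rewrite big1 ?addr0 // => m /andP[/eqP m0 /eqP[]]; apply/val_inj/eqP.
  by rewrite /= -mdeg_eq0 m0.
rewrite mul1r -horner_coef0 -[_.[0]]/(horner_eval 0 (\det M)) -det_map_mx.
have -> : map_mx (horner_eval (0 : K)) M = 1%:M.
  apply/matrixP => i j; rewrite !mxE /horner_eval hornerD hornerN hornerM hornerX.
  by rewrite mul0r subr0 -polyC_natr hornerC.
by rewrite det1.
Qed.

End GradedTrace.

(** * Invariants of a reflection group and Chevalley's lemma *)

Section ReflectionGroup.
Variables (K : fieldType) (charK : [pchar K] =i pred0) (r : nat).
Variables (W : seq 'M[K]_r) (HW : finite_reflection_group W).
Local Notation S := {mpoly K[r]}.
Implicit Types (g h : 'M[K]_r) (p q f : S).

Lemma refl_unit g : g \in W -> g \in unitmx.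
Proof. by case: HW => _ _ WV _ _ /WV/andP[]. Qed.

Lemma refl_inv g : g \in W -> invmx g \in W.
Proof. by case: HW => _ _ WV _ _ /WV/andP[]. Qed.

Lemma refl_mul g h : g \in W -> h \in W -> g *m h \in W.
Proof. by case: HW => _ _ _ WM _; apply: WM. Qed.

Lemma refl_one : 1%:M \in W.
Proof. by case: HW. Qed.

Lemma refl_size_neq0 : (size W)%:R != 0 :> K.
Proof. by rewrite (pcharf0P K).1 // size_eq0; apply: contraTneq refl_one => ->. Qed.

Lemma refl_perm_mull g : g \in W -> perm_eq (map (mulmx g) W) W.
Proof.
move=> gW; have uW : uniq W by case: HW.
have inj : injective (mulmx g : 'M[K]_r -> _) := can_inj (mulKmx (refl_unit gW)).
have us : uniq (map (mulmx g) W) by rewrite map_inj_uniq.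
apply: uniq_perm => //.
have [] := uniq_min_size us (s2 := W) _ _; rewrite ?size_map //.
by move=> x /mapP[h hW ->]; apply: refl_mul.
Qed.

Lemma refl_sum_mull (V : nmodType) (F : 'M[K]_r -> V) g : g \in W ->
  \sum_(h <- W) F (g *m h) = \sum_(h <- W) F h.
Proof.
by move=> gW; rewrite -[RHS](perm_big _ (refl_perm_mull gW)) big_map.
Qed.

Definition winv p := forall g, g \in W -> pact g p = p.

Lemma winvC c : winv c%:MP. Proof. by move=> g _; apply: pactC. Qed.
Lemma winv0 : winv 0. Proof. by move=> g _; rewrite raddf0. Qed.
Lemma winvD p q : winv p -> winv q -> winv (p + q).
Proof. by move=> ip iq g gW; rewrite raddfD /= ip ?iq. Qed.
Lemma winvN p : winv p -> winv (- p).
Proof. by move=> ip g gW; rewrite raddfN /= ip. Qed.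
Lemma winvM p q : winv p -> winv q -> winv (p * q).
Proof. by move=> ip iq g gW; rewrite rmorphM /= ip ?iq. Qed.
Lemma winvZ c p : winv p -> winv (c *: p).
Proof. by move=> ip g gW; rewrite linearZ /= ip. Qed.
Lemma winv_sum I (s : seq I) (P : pred I) (F : I -> S) :
  (forall i, P i -> winv (F i)) -> winv (\sum_(i <- s | P i) F i).
Proof. by move=> iF; elim/big_ind: _ => //; [exact: winv0|exact: winvD]. Qed.
Lemma winv_pihomog d p : winv p -> winv (pihomog mdeg d p).
Proof. by move=> ip g gW; rewrite pactE -pihomog_subst -pactE ip. Qed.

Definition wavg p : S := (size W)%:R^-1 *: \sum_(g <- W) pact g p.

Fact wavg_is_linear : linear wavg.
Proof.
move=> c p q; rewrite /wavg scalerA mulrC -scalerA -scalerDr; congr (_ *: _).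
by rewrite scaler_sumr -big_split; apply: eq_bigr => g _; rewrite linearP.
Qed.
HB.instance Definition _ := GRing.isLinear.Build K S S _ wavg wavg_is_linear.

Lemma wavg_winv p : winv (wavg p).
Proof.
move=> g gW; rewrite /wavg linearZ /=; congr (_ *: _); rewrite raddf_sum.
rewrite -[RHS](refl_sum_mull _ gW) big_seq [RHS]big_seq; apply: eq_bigr => h hW.
by rewrite pactM ?refl_unit.
Qed.

Lemma wavgM a p : winv a -> wavg (a * p) = a * wavg p.
Proof.
move=> ia; rewrite /wavg -scalerAr mulr_sumr big_seq [in RHS]big_seq.
by congr (_ *: _); apply: eq_bigr => g gW; rewrite rmorphM /= ia.
Qed.

Lemma wavg_id p : winv p -> wavg p = p.
Proof.
move=> ip; rewrite /wavg big_seq (eq_bigr (fun=> p)) => [|g /ip //].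
by rewrite -big_seq big_const_seq count_predT iter_addr_0 -scaler_nat scalerA
  mulVf ?scale1r // refl_size_neq0.
Qed.

Lemma wavg_homog d p : p \is d.-homog -> wavg p \is d.-homog.
Proof. by move=> pd; apply: rpredZ; apply: rpred_sum => g _; apply: pact_homog. Qed.

(** The Hilbert ideal, generated by all invariants without constant term. As an inductive predicate
    it is handled by induction on sums, without fixing a list of generators. *)
Inductive in_ideal : S -> Prop :=
| in_ideal0 : in_ideal 0
| in_idealD p q : in_ideal p -> in_ideal q -> in_ideal (p + q)
| in_ideal_gen a p : winv a -> a@_0%MM = 0 -> in_ideal (a * p).

Lemma in_idealMl q p : in_ideal p -> in_ideal (q * p).
Proof.
elim=> [|p1 p2 _ IH1 _ IH2|a p1 ia a0]; first by rewrite mulr0; exact: in_ideal0.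
  by rewrite mulrDr; apply: in_idealD.
by rewrite mulrCA; apply: in_ideal_gen.
Qed.

Lemma in_idealZ c p : in_ideal p -> in_ideal (c *: p).
Proof. by rewrite -mul_mpolyC; apply: in_idealMl. Qed.

Lemma in_idealN p : in_ideal p -> in_ideal (- p).
Proof. by rewrite -scaleN1r; apply: in_idealZ. Qed.

Lemma in_idealB p q : in_ideal p -> in_ideal q -> in_ideal (p - q).
Proof. by move=> Ip /in_idealN; apply: in_idealD. Qed.

Lemma in_ideal_sum I (s : seq I) (P : pred I) (F : I -> S) :
  (forall i, P i -> in_ideal (F i)) -> in_ideal (\sum_(i <- s | P i) F i).
Proof. by move=> IF; elim/big_ind: _ => //; [exact: in_ideal0|exact: in_idealD]. Qed.

Lemma in_ideal_winv a : winv a -> a@_0%MM = 0 -> in_ideal a.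
Proof. by rewrite -{3}[a]mulr1; apply: in_ideal_gen. Qed.

Lemma in_ideal_pact g p : g \in W -> in_ideal p -> in_ideal (pact g p).
Proof.
move=> gW; elim=> [|p1 p2 _ IH1 _ IH2|a p1 ia a0]; first by rewrite raddf0; exact: in_ideal0.
  by rewrite raddfD; apply: in_idealD.
by rewrite rmorphM /= ia //; apply: in_ideal_gen.
Qed.

Lemma in_ideal_pihomog d p : in_ideal p -> in_ideal (pihomog mdeg d p).
Proof.
elim=> [|p1 p2 _ IH1 _ IH2|a p1 ia a0]; first by rewrite raddf0; exact: in_ideal0.
  by rewrite raddfD; apply: in_idealD.
rewrite (@pihomog_partitionE _ _ mdeg _ a (leqnn _)) mulr_suml linear_sum /=.
apply: in_ideal_sum => e _; have [le_ed|lt_de] := leqP e d; last first.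
  rewrite mulrC (pihomog_mulr_lt _ (pihomogP _ _ _) lt_de); exact: in_ideal0.
rewrite -(subnK le_ed) mulrC pihomog_mulr ?pihomogP // mulrC.
apply: in_ideal_gen; first exact: winv_pihomog.
by rewrite mcoeff_pihomog; case: eqP; rewrite ?a0.
Qed.

(** The quotients q = (g f - f) / l are divided differences. Since g - 1 = c d has rank one, g^-1 -
    1 is also a column times the row d, so the linear form l with coefficients d serves for every f;
    products follow from a twisted Leibniz rule. *)
Lemma reflection_twisted_deriv g : g \in W -> pseudo_reflection g ->
  exists2 l : S, l != 0 /\ l \is 1.-homog &
    forall f, exists q, pact g f = f + l * q.
Proof.
move=> gW /eqP rk1; have gU := refl_unit gW.
have [c [d gE]] : exists c : 'cV[K]_r, exists d : 'rV[K]_r, g - 1%:M = c *m d.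
  move: (mulmx_base (g - 1%:M)); move: (col_base _) (row_base _).
  by rewrite rk1 => c d <-; exists c, d.
have gVE : invmx g = 1%:M + (- invmx g *m c) *m d.
  rewrite -mulmxA -gE mulNmx mulmxBr mulVmx // mulmx1 opprB addrC subrK //.
pose l : S := \sum_j d 0 j *: 'X_j.
have lX j : l@_(U_(j)%MM) = d 0 j.
  rewrite /l linear_sum (bigD1 j) //= mcoeffZ mcoeffX eqxx mulr1 big1 ?addr0 // => k kj.
  by rewrite mcoeffZ mcoeffX eq_mnm1 (negPf kj) mulr0.
exists l.
  split; last by apply: rpred_sum => j _; apply: rpredZ; rewrite dhomogX /= mdeg1.
  apply: contra_eq_neq rk1 => l0; rewrite gE; have -> : d = 0.
    by apply/rowP => j; rewrite mxE -lX l0 mcoeff0.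
  by rewrite mulmx0 mxrank0.
elim/mpoly_ind_alg => [a|i|p q [u pu] [v qv]|p q [u pu] [v qv]].
- by exists 0; rewrite pactC mulr0 addr0.
- exists ((- invmx g *m c) i 0)%:MP; rewrite pactE substX [in LHS]gVE.
  under eq_bigr do rewrite mxE scalerDl.
  rewrite big_split /=; congr (_ + _); first by rewrite -substX subst1.
  rewrite mulrC mul_mpolyC scaler_sumr; apply: eq_bigr => j _.
  by rewrite mxE big_ord1 scalerA.
- by exists (u + v); rewrite raddfD /= pu qv mulrDr addrACA.
- exists (p * v + u * q + l * (u * v)); rewrite rmorphM /= pu qv.
  rewrite mulrDl !mulrDr -!addrA; congr (_ + _); rewrite [p * (l * v)]mulrCA; congr (_ + _).
  by rewrite -mulrA; congr (_ + _); rewrite mulrACA -mulrA.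
Qed.

(* Induction on the degree of p0: for a reflection with linear form l, the relation is
   inherited by the quotients (g p - p) / l, so p0 is congruent to all its conjugates,
   hence to its average, modulo the ideal. *)
Lemma chevalley_key d n (a0 p0 : S) (a p : 'I_n -> S) :
    winv a0 -> (forall i, winv (a i)) ->
    ~ (exists2 b : 'I_n -> S, forall i, winv (b i) & a0 = \sum_i b i * a i) ->
    p0 \is d.-homog -> a0 * p0 + \sum_i a i * p i = 0 -> in_ideal p0.
Proof.
move=> ia0 ia na; elim: d p0 p => [|d IHd] p0 p p0h rel.
  have [c p0E] : exists c, p0 = c%:MP by exists p0@_0%MM; exact: homog0C.
  move: rel; rewrite {}p0E; case: (eqVneq c 0) => [->|c0] rel.
    rewrite mpolyC0; exact: in_ideal0.
  (* A nonzero constant [p0 = c] is excluded by [na]: averaging the relation and dividing by c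
     writes [a0] as an invariant combination of the [a i]. *)
  case: na; exists (fun i => - (c^-1 *: wavg (p i))).
    by move=> i; apply/winvN/winvZ/wavg_winv.
  have := congr1 wavg rel; rewrite raddfD raddf0 /= wavgM //.
  rewrite (wavg_id (winvC _)) linear_sum /= => /eqP; rewrite addrC addr_eq0 => /eqP e.
  under eq_bigr do rewrite mulNr -scalerAl mulrC -wavgM //.
  rewrite sumrN -scaler_sumr e scalerN opprK mulrC mul_mpolyC scalerA mulVf //.
  by rewrite scale1r.
have stepW g : g \in W -> pseudo_reflection g -> in_ideal (p0 - pact g p0).
  move=> gW gr; have [l [l0 lh] ld] := reflection_twisted_deriv gW gr.
  have [q0 q0E] := ld p0; have /fin_all_exists[q qE] := fun i => ld (p i).
  (* The quotient [q0] comes with no degree; its component of degree d gives the same product with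
     [l], because [p0] and its conjugate are homogeneous of degree d+1. *)
  pose q0' := pihomog mdeg d q0.
  have q0'E : pact g p0 = p0 + l * q0'.
    have /pihomog_dE := pact_homog g p0h; rewrite q0E raddfD /= pihomog_dE // => <-.
    by rewrite -[d.+1]addn1 mulrC pihomog_mulr // mulrC.
  rewrite q0'E opprD addNKr -mulrN; apply/in_idealMl/in_idealN.
  apply: (IHd _ q); first exact: pihomogP.
  apply: (mulfI l0); rewrite mulr0.
  have := congr1 (pact g) rel; rewrite pact_zero pact_add pact_mul pact_sum ia0 // q0'E.
  under eq_bigr do rewrite pact_mul ia // qE mulrDr.
  rewrite big_split /= mulrDr addrACA rel add0r => e; rewrite -[RHS]e mulrDr.
  rewrite mulrCA; congr (_ + _); rewrite mulr_sumr.
  by apply: eq_bigr => i _; rewrite mulrCA.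
have stepG g : g \in W -> in_ideal (p0 - pact g p0).
  case: HW => _ oneW _ _ gen gW; have [s [sW ->]] := gen g gW.
  elim: s sW {gW g} => [_|t s IHs] /=; first by rewrite pact1 subrr; exact: in_ideal0.
  case/andP=> /andP[tW tr] sW; set u := foldr _ _ _ in IHs *.
  have uU : u \in unitmx.
    rewrite /u; elim: (s) sW => [|t' s' IH] /=; first by rewrite unitmx1.
    by case/andP=> /andP[t'W _] /IH; rewrite unitmx_mul (refl_unit t'W).
  rewrite pactM ?(refl_unit tW) //.
  have -> : p0 - pact t (pact u p0) = (p0 - pact t p0) + pact t (p0 - pact u p0).
    by rewrite raddfB /= addrA subrK.
  by apply: in_idealD; [apply: stepW|apply: in_ideal_pact => //; apply: IHs].
have : in_ideal (p0 - wavg p0).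
  have -> : p0 - wavg p0 = (size W)%:R^-1 *: \sum_(g <- W) (p0 - pact g p0).
    rewrite sumrB scalerBr; congr (_ - _); rewrite big_const_seq count_predT.
    by rewrite iter_addr_0 -scaler_nat scalerA mulVf ?scale1r // refl_size_neq0.
  by apply: in_idealZ; rewrite big_seq; apply: in_ideal_sum.
move/in_idealD => /(_ (wavg p0)); rewrite subrK; apply.
by apply: in_ideal_winv; [exact: wavg_winv|apply: homog_mcoeff0 (wavg_homog p0h) _].
Qed.

End ReflectionGroup.

(** * Free rows over a domain and rank over its fraction field *)

Section FractionRank.
Variable D : idomainType.

Lemma fraction_numden (x : {fraction D}) :
  exists n d : D, d != 0 /\ tofrac d * x = tofrac n.
Proof.
elim/quotW: x => y; have y0 := denom_ratioP y.
exists (frac y).1, (frac y).2; split=> //; unlock FracField.tofrac.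
rewrite -[LHS]FracField.pi_mul; apply/eqmodP => /=.
by rewrite FracField.equivfE /FracField.mulf /= !numden_Ratio ?oner_neq0 ?mul1r ?mulr1 ?mulf_neq0 ?oner_neq0.
Qed.

Lemma common_denominator k (v : 'rV[{fraction D}]_k) :
  exists2 d : D, d != 0 & exists w : 'rV[D]_k, tofrac d *: v = map_mx (@tofrac D) w.
Proof.
have [n nd] := fin_all_exists (fun i => fraction_numden (v 0 i)).
have [d dE] := fin_all_exists nd.
exists (\prod_i d i); first by apply/prodf_neq0 => i _; case: (dE i).
exists (\row_i ((\prod_(j | j != i) d j) * n i)); apply/rowP => i; rewrite !mxE.
rewrite (bigD1 i) //= [d i * _]mulrC !tofracM -mulrA.
by case: (dE i) => _ ->.
Qed.

(** A kernel vector over the fraction field becomes a relation over [D] once multiplied by a common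
    denominator. *)
Lemma free_rows_det k m (A : 'M[D]_(k, m)) :
  (forall v : 'rV[D]_k, v *m A = 0 -> v = 0) -> row_free (map_mx (@tofrac D) A).
Proof.
move=> Afree; rewrite -kermx_eq0; apply/eqP/row_matrixP => i; rewrite row0.
have := row_sub i (kermx (map_mx (@tofrac D) A)); set v := row _ _.
move=> /sub_kermxP vA; have [d d0 [w wE]] := common_denominator v.
have w0 : w = 0.
  apply: Afree; have : map_mx (@tofrac D) (w *m A) = 0.
    by rewrite map_mxM -wE -scalemxAl vA scaler0.
  move=> /matrixP e; apply/matrixP => a b; apply/eqP; rewrite -tofrac_eq.
  by have := e a b; rewrite [LHS]mxE => ->; rewrite !mxE tofrac0.
have : tofrac d *: v = 0 by rewrite wE w0 map_mx0.
by move/eqP; rewrite scaler_eq0 tofrac_eq0 (negPf d0) => /eqP.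
Qed.

Lemma free_rows_leq k m (A : 'M[D]_(k, m)) :
  (forall v : 'rV[D]_k, v *m A = 0 -> v = 0) -> (k <= m)%N.
Proof. by move=> /free_rows_det /eqP <-; apply: rank_leq_col. Qed.

Lemma free_rows_det_neq0 m (A : 'M[D]_m) :
  (forall v : 'rV[D]_m, v *m A = 0 -> v = 0) -> \det A != 0.
Proof.
move=> /free_rows_det; rewrite row_free_unit unitmxE det_map_mx unitfE.
by rewrite tofrac_eq0.
Qed.

End FractionRank.

(** * Independence of equivariant vectors modulo the ideal, over the invariants, and over S *)

Section FreeModules.
Variables (K : fieldType) (charK : [pchar K] =i pred0) (r : nat).
Variables (W : seq 'M[K]_r) (HW : finite_reflection_group W).
Variable m : nat.
Local Notation S := {mpoly K[r]}.
Implicit Types (g h : 'M[K]_r) (p q f : S) (F : 'rV[S]_m).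

Definition vhom d F := forall j, F 0 j \is d.-homog.

Definition indep_mod_ideal k (z : 'I_k -> 'rV[S]_m) := forall c : 'I_k -> K,
  (forall j, in_ideal W ((\sum_i (c i)%:MP *: z i) 0 j)) -> forall i, c i = 0.

Definition winv_free k (z : 'I_k -> 'rV[S]_m) := forall a : 'I_k -> S,
  (forall i, winv W (a i)) -> \sum_i a i *: z i = 0 -> forall i, a i = 0.

(** Induction on the number of vectors. Either the first coefficient is an invariant combination of
    the others, and the first vector is absorbed into the remaining ones; or [chevalley_key] puts
    all its coordinates in the ideal, against independence. *)
Lemma homog_relation n (z : 'I_n -> 'rV[S]_m) (w : 'I_n -> nat) D (a : 'I_n -> S) :
    (forall i, winv W (a i)) -> (forall i, vhom (w i) (z i)) -> indep_mod_ideal z ->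
    (forall i, (w i <= D)%N -> a i \is (D - w i).-homog) ->
    (forall i, (D < w i)%N -> a i = 0) ->
  \sum_i a i *: z i = 0 -> forall i, a i = 0.
Proof.
elim: n z w a => [|n IHn] z w a ia zh indz ah a0 rel; first by case.
pose a' (i : 'I_n) := a (lift ord0 i); pose z' (i : 'I_n) := z (lift ord0 i).
pose w' (i : 'I_n) := w (lift ord0 i).
case: (classic (exists2 b : 'I_n -> S, forall i, winv W (b i) &
                  a ord0 = \sum_i b i * a' i)) => [[b0 ib0 a0E]|nex]; last first.
  have I0 j : in_ideal W (z ord0 0 j).
    apply: (chevalley_key charK HW (ia ord0) (fun i => ia (lift ord0 i)) nex (zh _ j)
              (p := fun i => z' i 0 j)).
    have := congr1 (fun F : 'rV_m => F 0 j) rel; rewrite /= big_ord_recl !mxE => e; rewrite -[RHS]e.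
    by congr (_ + _); rewrite summxE; apply: eq_bigr => i _; rewrite mxE.
  suff /eqP : ((ord0 == ord0 :> 'I_n.+1)%:R : K) = 0 by rewrite eqxx oner_eq0.
  apply: (indz (fun i => (i == ord0)%:R)) => j.
  rewrite (bigD1 ord0) //= big1 ?addr0 => [|i /negPf ->].
    by rewrite mpolyC1 scale1r.
  by rewrite mpolyC0 scale0r.
(* Homogeneous version of [b0], chosen so that the modified vector [z' i + b i *: z ord0] keeps the
   degree [w' i]. *)
pose b i := if (w ord0 <= w' i)%N then pihomog mdeg (w' i - w ord0) (b0 i) else 0.
have ib i : winv W (b i).
  by rewrite /b; case: ifP => _; [apply: winv_pihomog|apply: winv0].
have aE : a ord0 = \sum_i b i * a' i.
  have [leD|ltD] := leqP (w ord0) D; last first.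
    rewrite a0 // big1 // => i _; rewrite /b; case: leqP => [le|]; last by rewrite mul0r.
    by rewrite /a' a0 ?mulr0 // (leq_trans ltD).
  rewrite -(pihomog_dE (ah _ leD)) a0E linear_sum; apply: eq_bigr => i _ /=.
  have [leD'|ltD'] := leqP (w' i) D; last by rewrite /a' a0 // !mulr0 raddf0.
  have a'h : a' i \is (D - w' i).-homog by apply: ah.
  rewrite /b; case: leqP => le.
    by rewrite -(pihomog_mulr _ _ a'h) addnC addnBA // subnK.
  by rewrite mul0r (pihomog_mulr_lt _ a'h) // ltn_sub2l // (leq_trans le).
pose y i := z' i + b i *: z ord0.
have y0 i : a' i = 0.
  apply: (IHn y w') => // {i} [i|i j|c Ic i|i|i|].
  - exact: ia.
  - rewrite !mxE; apply: rpredD; first exact: zh.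
    rewrite /b; case: leqP => le; last by rewrite mul0r; apply: rpred0.
    have := dhomogM (pihomogP mdeg (w' i - w ord0)%N (b0 i)) (zh ord0 j).
    by rewrite subnK.
  (* Modulo the ideal an invariant acts by its constant term, so a K-relation between the [y k] is
     one between the [z j], whose coefficient at the first vector collects the constant terms of the
     [b k]. *)
  - pose c' j := if unlift ord0 j is Some k then c k else \sum_k c k * (b k)@_0%MM.
    have c'0 : c' ord0 = \sum_k c k * (b k)@_0%MM by rewrite /c' unlift_none.
    have c'S k : c' (lift ord0 k) = c k by rewrite /c' liftK.
    rewrite -c'S; apply: indz => j {i}.
    rewrite big_ord_recl c'0.
    pose rest := \sum_k (b k - ((b k)@_0%MM)%:MP) * ((c k)%:MP * z ord0 0 j).
    have restI : in_ideal W rest.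
      apply: in_ideal_sum => k _; apply: in_ideal_gen.
        by apply: winvD => //; apply/winvN/winvC.
      by rewrite mcoeffB mcoeffC eqxx mulr1 subrr.
    have := in_idealB (Ic j) restI; congr (in_ideal W _).
    rewrite /rest !mxE !summxE rmorph_sum /= mulr_suml -sumrB -big_split /=.
    by apply: eq_bigr => k _; rewrite /y !mxE c'S mpolyCM /z'; ring.
  - exact: ah.
  - exact: a0.
  - rewrite -[RHS]rel big_ord_recl aE scaler_suml -big_split /=.
    apply: eq_bigr => i _; rewrite /y scalerDr scalerA addrC mulrC //.
move=> i; case: (unliftP ord0 i) => [k ->|->]; first exact: y0.
by rewrite aE big1 // => k _; rewrite y0 mulr0.
Qed.

Lemma indep_mod_ideal_free k (z : 'I_k -> 'rV[S]_m) (w : 'I_k -> nat) :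
  (forall i, vhom (w i) (z i)) -> indep_mod_ideal z -> winv_free z.
Proof.
move=> zh indz a ia rel i; apply: homog_eq_pihomog => d; rewrite raddf0.
(* The degree-D part of the relation is the one in which the degree-d component of [a i] occurs. *)
pose D := (d + w i)%N.
pose aD j := if (w j <= D)%N then pihomog mdeg (D - w j) (a j) else 0.
have -> : pihomog mdeg d (a i) = aD i by rewrite /aD leq_addl addnK.
apply: (@homog_relation _ z w D aD) => // [j|j|j|].
- by rewrite /aD; case: ifP => _; [apply: winv_pihomog|apply: winv0].
- by rewrite /aD => ->; apply: pihomogP.
- by rewrite /aD ltnNge => /negPf ->.
apply/rowP => j; rewrite summxE mxE.
have := congr1 (fun F : 'rV_m => pihomog mdeg D (F 0 j)) rel.
rewrite /= summxE mxE raddf0 linear_sum => e; rewrite -[RHS]e; apply: eq_bigr => l _.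
rewrite !mxE /aD; case: leqP => le.
  by have := pihomog_mulr (D - w l) (a l) (zh l j); rewrite subnK.
by rewrite mul0r /= (pihomog_mulr_lt _ (zh l j)).
Qed.

Variable rho : 'M[K]_r -> 'M[K]_m.
Hypothesis rho1 : rho 1%:M = 1%:M.
Hypothesis rhoM : forall g h, g \in W -> h \in W -> rho (g *m h) = rho g *m rho h.

Lemma rho_unit g : g \in W -> rho g \in unitmx.
Proof.
move=> gW; have : rho g *m rho (invmx g) = 1%:M.
  by rewrite -rhoM ?(refl_inv HW) // mulmxV ?(refl_unit HW).
by move/mulmx1_unit => [].
Qed.

Lemma tactD A F G : tact rho A (F + G) = tact rho A F + tact rho A G.
Proof. by rewrite /tact map_mxD mulmxDl. Qed.

Lemma tactZ A p F : tact rho A (p *: F) = pact A p *: tact rho A F.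
Proof. by rewrite /tact map_mxZ scalemxAl. Qed.

Lemma tact0 A : tact rho A 0 = 0.
Proof. by rewrite /tact map_mx0 mul0mx. Qed.

Lemma tact_sum A I (s : seq I) (P : pred I) (F : I -> 'rV[S]_m) :
  tact rho A (\sum_(i <- s | P i) F i) = \sum_(i <- s | P i) tact rho A (F i).
Proof. by apply: (big_morph _ (tactD A) (tact0 A)). Qed.

Lemma tactE A F j : tact rho A F 0 j = \sum_i (invmx (rho A)) i j *: pact A (F 0 i).
Proof.
by rewrite mxE; apply: eq_bigr => i _; rewrite !mxE mulrC mul_mpolyC.
Qed.

Lemma tactM A B F : A \in unitmx -> B \in unitmx -> rho A \in unitmx ->
    rho B \in unitmx -> rho (A *m B) = rho A *m rho B ->
  tact rho (A *m B) F = tact rho A (tact rho B F).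
Proof.
move=> uA uB urA urB rAB.
have E1 : map_mx (pact (A *m B)) F = map_mx (pact A) (map_mx (pact B) F).
  by apply/matrixP => i j; rewrite !mxE pactM.
have E2 (C : 'M[K]_m) : map_mx (pact A) (map_mx (fun c => c%:MP) C) =
    map_mx (fun c => c%:MP) C by apply/matrixP => i j; rewrite !mxE /= pactC.
by rewrite /tact map_mxM /= E1 E2 -mulmxA rAB (invmxM urA urB) (map_mxM (@mpolyC r K)).
Qed.

Definition vinv F := forall g, g \in W -> tact rho g F = F.

Lemma vinvD F G : vinv F -> vinv G -> vinv (F + G).
Proof. by move=> iF iG g gW; rewrite tactD iF ?iG. Qed.
Lemma vinv0 : vinv 0. Proof. by move=> g _; apply: tact0. Qed.
Lemma vinvZ p F : winv W p -> vinv F -> vinv (p *: F).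
Proof. by move=> ip iF g gW; rewrite tactZ ip ?iF. Qed.
Lemma vinvB F G : vinv F -> vinv G -> vinv (F - G).
Proof. by move=> iF iG; apply: vinvD => // g gW; rewrite -scaleN1r tactZ rmorphN1 iG. Qed.
Lemma vinv_sum I (s : seq I) (P : pred I) (F : I -> 'rV[S]_m) :
  (forall i, P i -> vinv (F i)) -> vinv (\sum_(i <- s | P i) F i).
Proof. by move=> iF; elim/big_ind: _ => //; [exact: vinv0|exact: vinvD]. Qed.

Definition vpih d F : 'rV[S]_m := map_mx (pihomog mdeg d) F.

Lemma vpih_hom d F : vhom d (vpih d F).
Proof. by move=> j; rewrite mxE; apply: pihomogP. Qed.

Lemma vpih_id d F : vhom d F -> vpih d F = F.
Proof. by move=> Fh; apply/rowP => j; rewrite mxE pihomog_dE. Qed.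

Lemma vpihD d F G : vpih d (F + G) = vpih d F + vpih d G.
Proof. by apply/rowP => i; rewrite !mxE raddfD. Qed.

Lemma vpih0 d : vpih d 0 = 0.
Proof. by apply/rowP => i; rewrite !mxE raddf0. Qed.

Lemma vpih_sum d I (s : seq I) (P : pred I) (F : I -> 'rV[S]_m) :
  vpih d (\sum_(i <- s | P i) F i) = \sum_(i <- s | P i) vpih d (F i).
Proof. by apply: (big_morph _ (vpihD d) (vpih0 d)). Qed.

Lemma vpih_tact d A F : vpih d (tact rho A F) = tact rho A (vpih d F).
Proof.
apply/rowP => j; rewrite mxE !tactE linear_sum; apply: eq_bigr => i _ /=.
by rewrite linearZ /= mxE pihomog_subst.
Qed.

Lemma vinv_vpih d F : vinv F -> vinv (vpih d F).
Proof. by move=> iF g gW; rewrite -vpih_tact iF. Qed.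

Lemma tact_vhom d A F : vhom d F -> vhom d (tact rho A F).
Proof.
move=> Fh j; rewrite tactE; apply: rpred_sum => i _.
by apply: rpredZ; apply: pact_homog.
Qed.

Definition vavg F : 'rV[S]_m := ((size W)%:R^-1)%:MP *: \sum_(g <- W) tact rho g F.

Lemma vavg_vinv F : vinv (vavg F).
Proof.
move=> g gW; rewrite /vavg tactZ pactC tact_sum; congr (_ *: _).
rewrite -[RHS](refl_sum_mull HW _ gW) big_seq [RHS]big_seq; apply: eq_bigr => h hW.
by rewrite tactM ?rhoM ?rho_unit ?(refl_unit HW).
Qed.

Lemma vavg_id F : vinv F -> vavg F = F.
Proof.
move=> iF; rewrite /vavg big_seq (eq_bigr (fun=> F)) => [|g /iF //].
rewrite -big_seq big_const_seq count_predT iter_addr_0 -scaler_nat scalerA.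
by rewrite -mpolyC_nat -mpolyCM mulVf ?scale1r ?mpolyC1 ?scale1r // refl_size_neq0.
Qed.

Lemma vavgZ p F : winv W p -> vavg (p *: F) = p *: vavg F.
Proof.
move=> ip; rewrite /vavg scalerA mulrC -scalerA; congr (_ *: _).
by rewrite scaler_sumr big_seq [RHS]big_seq; apply: eq_bigr => g gW; rewrite tactZ ip.
Qed.

Lemma vavgD F G : vavg (F + G) = vavg F + vavg G.
Proof.
by rewrite /vavg -scalerDr -big_split; congr (_ *: _); apply: eq_bigr => g _; rewrite tactD.
Qed.

Lemma vavg0 : vavg 0 = 0.
Proof. by rewrite /vavg big1 ?scaler0 // => g _; apply: tact0. Qed.

Lemma vavg_sum I (s : seq I) (P : pred I) (F : I -> 'rV[S]_m) :
  vavg (\sum_(i <- s | P i) F i) = \sum_(i <- s | P i) vavg (F i).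
Proof. by apply: (big_morph _ vavgD vavg0). Qed.

(* Multiplying by the conjugates of f turns a relation over S into one over the invariants. *)
Lemma winv_free_free k (z : 'I_k -> 'rV[S]_m) : (forall i, vinv (z i)) ->
  winv_free z -> forall f : 'I_k -> S, \sum_i f i *: z i = 0 -> forall i, f i = 0.
Proof.
move=> iz fz f rel i; apply/eqP; apply: contraT => fi0.
pose h := \prod_(g <- rem 1%:M W) pact g (f i).
have hfE : h * f i = \prod_(g <- W) pact g (f i).
  by rewrite (big_rem 1%:M (refl_one HW)) /= pact1 mulrC.
have ihf : winv W (h * f i).
  move=> g gW; rewrite hfE rmorph_prod /=.
  rewrite -[RHS](perm_big _ (refl_perm_mull HW gW)) big_map big_seq [RHS]big_seq.
  by apply: eq_bigr => g' g'W; rewrite pactM ?(refl_unit HW).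
(* Only the i-th coefficient h f_i, the norm of f_i, is already invariant; averaging the relation
   makes the others invariant and leaves this one unchanged. *)
have := fz (fun j => wavg W (h * f j)) (fun j => wavg_winv HW _) _ i.
rewrite wavg_id // hfE => /(_ _)/eqP; rewrite prodf_seq_eq0.
have -> : has (fun g => true && (pact g (f i) == 0)) W = false.
  apply/hasP => -[g gW /=]; rewrite pact_eq0 ?(refl_unit HW) // (negPf fi0) //.
apply; have : vavg (h *: \sum_j f j *: z j) = 0 by rewrite rel scaler0 vavg0.
move=> e; rewrite -[RHS]e scaler_sumr vavg_sum; apply: eq_bigr => j _.
rewrite scalerA /vavg /wavg -mul_mpolyC -[LHS]scalerA; congr (_ *: _).
rewrite scaler_suml big_seq [RHS]big_seq; apply: eq_bigr => g gW.
by rewrite tactZ iz.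
Qed.

End FreeModules.

(** * Homogeneous bases of the module of equivariants over the invariants *)

Section Bases.
Variables (K : fieldType) (charK : [pchar K] =i pred0) (r : nat).
Variables (W : seq 'M[K]_r) (HW : finite_reflection_group W).
Variable m : nat.
Local Notation S := {mpoly K[r]}.
Variable rho : 'M[K]_r -> 'M[K]_m.
Hypothesis rho1 : rho 1%:M = 1%:M.
Hypothesis rhoM : forall g h, g \in W -> h \in W -> rho (g *m h) = rho g *m rho h.
Implicit Types (g h : 'M[K]_r) (p q f : S) (F : 'rV[S]_m).

Definition winv_span k (z : 'I_k -> 'rV[S]_m) F :=
  exists2 b : 'I_k -> S, forall i, winv W (b i) & F = \sum_i b i *: z i.

Lemma winv_span0 k (z : 'I_k -> 'rV[S]_m) : winv_span z 0.
Proof.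
by exists (fun=> 0) => [i|]; [exact: winv0|rewrite big1 // => i _; rewrite scale0r].
Qed.

Lemma winv_spanD k (z : 'I_k -> 'rV[S]_m) F G :
  winv_span z F -> winv_span z G -> winv_span z (F + G).
Proof.
move=> [b1 ib1 ->] [b2 ib2 ->]; exists (fun i => b1 i + b2 i).
  by move=> i; apply: winvD.
by rewrite -big_split; apply: eq_bigr => i _; rewrite scalerDl.
Qed.

Lemma winv_span_sum k (z : 'I_k -> 'rV[S]_m) I (s : seq I) (P : pred I) (F : I -> 'rV[S]_m) :
  (forall i, P i -> winv_span z (F i)) -> winv_span z (\sum_(i <- s | P i) F i).
Proof. by move=> sF; elim/big_ind: _ => //; [exact: winv_span0|exact: winv_spanD]. Qed.

Lemma winv_spanZ k (z : 'I_k -> 'rV[S]_m) a F :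
  winv W a -> winv_span z F -> winv_span z (a *: F).
Proof.
move=> ia [b ib ->]; exists (fun i => a * b i) => [i|]; first exact: winvM.
by rewrite scaler_sumr; apply: eq_bigr => i _; rewrite scalerA.
Qed.

Lemma sum_vpih F : exists n, F = \sum_(d < n) vpih d F.
Proof.
exists (\max_(j < m) msize (F 0%R j)); apply/rowP => j; rewrite summxE.
under eq_bigr do rewrite mxE; apply: pihomog_partitionE.
exact: (leq_bigmax (F := fun j => msize (F 0%R j)) j).
Qed.

(* Graded Nakayama lemma. *)
Lemma span_of_mod_ideal k (z : 'I_k -> 'rV[S]_m) (w : 'I_k -> nat) :
    (forall i, vinv W rho (z i)) -> (forall i, vhom (w i) (z i)) ->
    (forall d F, vinv W rho F -> vhom d F -> exists c : 'I_k -> K,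
       forall j, in_ideal W ((F - \sum_i (c i)%:MP *: z i) 0 j)) ->
  forall F, vinv W rho F -> winv_span z F.
Proof.
move=> iz zh modI; suff spd d : forall F, vinv W rho F -> vhom d F -> winv_span z F.
  move=> F iF; have [n ->] := sum_vpih F; apply: winv_span_sum => d _.
  by apply: (spd d); [apply: vinv_vpih|apply: vpih_hom].
elim/ltn_ind: d => d IHd F iF Fh; have [c cI] := modI d F iF Fh.
pose E := \sum_(i | w i == d) (c i)%:MP *: z i.
have EE : E = vpih d (\sum_i (c i)%:MP *: z i).
  apply/rowP => j; rewrite !mxE !summxE linear_sum /= /E big_mkcond /=.
  apply: eq_bigr => i _; rewrite [in RHS]mxE mul_mpolyC linearZ /=.
  case: eqP => [<-|/eqP wd]; last by rewrite (pihomog_ne0 _ (zh i j)) ?scaler0.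
  by rewrite mxE mul_mpolyC (pihomog_dE (zh i j)).
have iE : vinv W rho E by apply: vinv_sum => i _; apply: vinvZ => //; apply: winvC.
have sE : winv_span z E.
  apply: winv_span_sum => i _; exists (fun j => ((i == j)%:R * c i)%:MP) => [j|].
    exact: winvC.
  rewrite (bigD1 i) //= eqxx mul1r big1 ?addr0 // => j /negPf ji.
  by rewrite eq_sym ji mul0r mpolyC0 scale0r.
have FEI j : in_ideal W ((F - E) 0 j).
  have := in_ideal_pihomog d (cI j); congr (in_ideal W _).
  rewrite [(F - _) 0 j]mxE raddfD /= [in RHS]mxE (pihomog_dE (Fh j)); congr (_ + _).
  by rewrite EE !mxE raddfN.
(* The average of a p e_j is a times the average of p e_j. As [a] has no constant term, its degree-d
   part involves only equivariants of degree below d, to which the induction applies. *)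
have lowI u j : in_ideal W u ->
    winv_span z (vpih d (vavg W rho (u *: delta_mx 0 j))).
  elim=> [|p q _ IHp _ IHq|a q ia a0].
  - rewrite scale0r vavg0 vpih0; exact: winv_span0.
  - by rewrite scalerDl vavgD vpihD; apply: winv_spanD.
  - rewrite -scalerA vavgZ //; set v := vavg _ _ _; have iv : vinv W rho v by apply: vavg_vinv.
    have -> : vpih d (a *: v) = \sum_(e < d.+1) pihomog mdeg e a *: vpih (d - e) v.
      apply/rowP => l; rewrite summxE !mxE pihomog_mul.
      by apply: eq_bigr => e _; rewrite !mxE.
    apply: winv_span_sum => -[[|e] /= le] _.
      have := homog0C (pihomogP mdeg 0 a); rewrite mcoeff_pihomog mdeg0 eqxx a0 mpolyC0 => ->.
      rewrite scale0r; exact: winv_span0.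
    apply: winv_spanZ; first exact: winv_pihomog.
    apply: (IHd (d - e.+1)%N); [|exact: vinv_vpih|exact: vpih_hom].
    by rewrite ltn_subrL /=; apply: leq_trans (le : (e.+1 <= d)%N).
have FEh : vhom d (F - E).
  by move=> j; rewrite !mxE; apply: rpredB => //; rewrite EE; apply: vpih_hom.
rewrite -[F](subrK E); apply: winv_spanD => //.
have iFE : vinv W rho (F - E) by apply: vinvB.
rewrite -(vpih_id FEh) -(vavg_id charK HW iFE) {1}[F - E]row_sum_delta vavg_sum.
rewrite vpih_sum.
by apply: winv_span_sum => j _; apply: lowI.
Qed.

Definition winv_basis k (z : 'I_k -> 'rV[S]_m) (w : 'I_k -> nat) :=
  [/\ forall i, vinv W rho (z i), forall i, vhom (w i) (z i),
      forall F, vinv W rho F -> winv_span z F & winv_free W z].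

Lemma free_matrix k (z : 'I_k -> 'rV[S]_m) :
    (forall i, vinv W rho (z i)) -> winv_free W z ->
  forall v : 'rV[S]_k, v *m \matrix_i z i = 0 -> v = 0.
Proof.
move=> iz fz v; rewrite mulmx_sum_row; under eq_bigr do rewrite rowK.
by move/(winv_free_free charK HW iz fz) => v0; apply/rowP => i; rewrite v0 mxE.
Qed.

(** Take a largest homogeneous family independent modulo the ideal. Its size is at most m, since it
    is free over S; maximality makes it span modulo the ideal, and Nakayama applies. This serves the
    determinant character of V, for which no basis of harmonics is given. *)
Lemma exists_winv_basis : exists k (z : 'I_k -> 'rV[S]_m) w, winv_basis z w.
Proof.
pose P k := exists (z : 'I_k -> 'rV[S]_m) (w : 'I_k -> nat),
  [/\ forall i, vinv W rho (z i), forall i, vhom (w i) (z i) & indep_mod_ideal W z].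
have Pm k : P k -> (k <= m)%N.
  move=> [z [w [iz zh indz]]].
  exact: free_rows_leq (free_matrix iz (indep_mod_ideal_free charK HW zh indz)).
have [k [z [w [iz zh indz]]] nPk] : exists2 k, P k & ~ P k.+1.
  apply: NNPP => nex; have PS k : P k -> P k.+1.
    by move=> Pk; apply: NNPP => nPk; apply: nex; exists k.
  suff /Pm : P m.+1 by rewrite ltnn.
  elim: m.+1 => [|k /PS //]; exists (fun=> 0), (fun=> 0%N).
  by split=> [[]|[]|c _ []].
exists k, z, w; split=> //; last exact: indep_mod_ideal_free zh indz.
apply: (span_of_mod_ideal iz zh) => d F iF Fh; apply: NNPP => nc; apply: nPk.
exists (fun i => if unlift ord0 i is Some j then z j else F).
exists (fun i => if unlift ord0 i is Some j then w j else d).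
split=> [i|i|c]; first by case: (unlift ord0 i).
  by case: (unlift ord0 i) => [j|]; [exact: zh|exact: Fh].
move=> cI; have {}cI j : in_ideal W
    (((c ord0)%:MP *: F + \sum_i (c (lift ord0 i))%:MP *: z i) 0 j).
  have := cI j; rewrite big_ord_recl unlift_none; congr (in_ideal W (fun_of_matrix _ 0 j)).
  by congr (_ + _); apply: eq_bigr => i _; rewrite liftK.
have c0 : c ord0 = 0.
  apply/eqP; apply: contraT => c0; case: nc; exists (fun i => - ((c ord0)^-1 * c (lift ord0 i))).
  move=> j; have := in_idealZ (c ord0)^-1 (cI j); congr (in_ideal W _).
  rewrite !mxE !summxE mul_mpolyC scalerDr scalerA mulVf // scale1r; congr (_ + _).
  rewrite scaler_sumr -sumrN; apply: eq_bigr => i _.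
  by rewrite !mxE !mul_mpolyC scaleNr opprK scalerA.
move=> i; case: (unliftP ord0 i) => [j ->|-> //].
apply: (indz (fun j => c (lift ord0 j))) => l; have := cI l.
by rewrite c0 mpolyC0 scale0r add0r.
Qed.

Lemma vavg_winvZ p F : vinv W rho F -> vavg W rho (p *: F) = wavg W p *: F.
Proof.
move=> iF; rewrite /vavg /wavg -mul_mpolyC -[RHS]scalerA; congr (_ *: _).
rewrite scaler_suml big_seq [RHS]big_seq; apply: eq_bigr => g gW.
by rewrite tactZ iF.
Qed.

End Bases.

(** * Graded trace of the averaging projector on S (x) M^* *)

Section BasisTrace.
Variables (K : fieldType) (charK : [pchar K] =i pred0) (r : nat).
Variables (W : seq 'M[K]_r) (HW : finite_reflection_group W).
Variable m : nat.
Local Notation S := {mpoly K[r]}.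
Variable rho : 'M[K]_r -> 'M[K]_m.
Hypothesis rho1 : rho 1%:M = 1%:M.
Hypothesis rhoM : forall g h, g \in W -> h \in W -> rho (g *m h) = rho g *m rho h.
Variables (k : nat) (z : 'I_k -> 'rV[S]_m) (w : 'I_k -> nat).
Hypothesis zbasis : winv_basis W rho z w.

Lemma gtr_wavg d : gtr d (wavg W) = (size W)%:R^-1 * \sum_(g <- W) gtr d (pact g).
Proof. by rewrite -gtr_sum -gtrZ. Qed.

Lemma winv_basis_unique (a b : 'I_k -> S) :
  (forall i, winv W (a i)) -> (forall i, winv W (b i)) ->
  \sum_i a i *: z i = \sum_i b i *: z i -> forall i, a i = b i.
Proof.
case: zbasis => _ _ _ fz ia ib e i; apply/eqP; rewrite -subr_eq0; apply/eqP.
apply: (fz (fun i => a i - b i)) => [j|].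
  by apply: winvD => //; apply: winvN.
under eq_bigr do rewrite scalerBl.
by rewrite sumrB e subrr.
Qed.

(* The coordinates of the averages of f e_j in the basis z are linear operators on S
   lowering degrees by w, so cyclicity of the trace applies to them. *)
Lemma winv_basis_trace d :
  \sum_(g <- W) \tr (invmx (rho g)) * gtr d (pact g) =
  \sum_i (if (w i <= d)%N then \sum_(g <- W) gtr (d - w i) (pact g) else 0).
Proof.
case: (zbasis) => iz zh spz fz.
have [b bE] : exists b : S * 'I_m -> 'I_k -> S, forall x, (forall i, winv W (b x i)) /\
    vavg W rho (x.1 *: delta_mx 0 x.2) = \sum_i b x i *: z i.
  apply: (functional_choice (fun x bx => (forall i, winv W (bx i)) /\
    vavg W rho (x.1 *: delta_mx 0 x.2) = \sum_i bx i *: z i)) => x.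
  by have [bx ibx e] := spz _ (vavg_vinv HW rho1 rhoM (x.1 *: delta_mx 0 x.2)); exists bx.
have ib x i : winv W (b x i) by case: (bE x).
have bsum x : vavg W rho (x.1 *: delta_mx 0 x.2) = \sum_i b x i *: z i by case: (bE x).
have blin j i : linear (fun f => b (f, j) i).
  move=> c f f'; apply: (winv_basis_unique (a := fun i => b (c *: f + f', j) i)
    (b := fun i => c *: b (f, j) i + b (f', j) i)) => // [l|].
    by apply: winvD => //; apply: winvZ.
  rewrite -bsum /= scalerDl vavgD -mul_mpolyC -scalerA vavgZ; last exact: winvC.
  rewrite (bsum (f, j)) (bsum (f', j)) scaler_sumr -big_split; apply: eq_bigr => l _.
  by rewrite scalerDl scalerA mul_mpolyC.
have bhom f e j i : f \is e.-homog ->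
    b (f, j) i = if (w i <= e)%N then pihomog mdeg (e - w i) (b (f, j) i) else 0.
  move=> fe; apply: (winv_basis_unique (a := b (f, j))
    (b := fun i => if (w i <= e)%N then pihomog mdeg (e - w i) (b (f, j) i) else 0)) => // [l|].
    by case: ifP => _; [apply: winv_pihomog|apply: winv0].
  rewrite -bsum /=; have Fh : vhom e (vavg W rho (f *: delta_mx 0 j)).
    move=> l; rewrite mxE mul_mpolyC summxE; apply: rpredZ; apply: rpred_sum => g _.
    apply: tact_vhom => l'; rewrite !mxE; case: (l' == j); rewrite ?andbF ?mulr0 ?mulr1 ?andbT //.
    exact: dhomog0.
  rewrite -{1}(vpih_id Fh) (bsum (f, j)) vpih_sum; apply: eq_bigr => l _ /=.
  apply/rowP => l'; rewrite !mxE; case: leqP => le.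
    by rewrite -{1}(subnK le) (pihomog_mulr _ _ (zh l l')).
  by rewrite mul0r (pihomog_mulr_lt _ (zh l l')).
have trb j i : gtr d (fun f => z i 0 j * b (f, j) i) =
    if (w i <= d)%N then gtr (d - w i) (fun f => b (z i 0 j * f, j) i) else 0.
  have zlin : linear (fun f => z i 0 j * f) by move=> c p q; rewrite mulrDr scalerAr.
  case: leqP => le; last first.
    apply: big1 => n /eqP nd; have Xh : 'X_[K, n] \is d.-homog by rewrite dhomogX /= nd.
    by rewrite (bhom _ _ j i Xh) leqNgt le mulr0 mcoeff0.
  apply: (gtr_cyclic zlin (blin j i)) => f fh; first by rewrite (bhom _ d) // le pihomogP.
  by have := dhomogM (zh i j) fh; rewrite subnKC.
(* Summing over j averages the vector f z_i, which gives (average of f) z_i: only the i-th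
   coordinate survives. *)
have sumb i f : \sum_j b (z i 0 j * f, j) i = wavg W f.
  have -> : wavg W f = (fun l => if l == i then wavg W f else 0) i by rewrite eqxx.
  apply: (winv_basis_unique (a := fun l => \sum_j b (z i 0 j * f, j) l)
            (b := fun l => if l == i then wavg W f else 0)) => [l|l|].
  - by apply: winv_sum.
  - by case: ifP => _; [apply: wavg_winv|apply: winv0].
  rewrite [RHS](bigD1 i) //= eqxx [X in _ + X]big1 ?addr0 => [|l /negPf ->]; last by rewrite scale0r.
  rewrite -(vavg_winvZ _ (iz i)) {2}[z i]row_sum_delta scaler_sumr vavg_sum.
  under eq_bigr do rewrite scaler_suml.
  rewrite exchange_big; apply: eq_bigr => j _ /=.
  by rewrite -bsum /= mulrC -scalerA scalerA.
(* Both sides are |W| times the trace of the averaging projector on S_d (x) M^*, computed from the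
   group elements on the left and from the coordinates in [z] on the right. *)
transitivity ((size W)%:R * gtr d (fun f => \sum_j vavg W rho (f *: delta_mx 0 j) 0 j)).
  rewrite -gtrZ (eq_gtr (O' := fun f => \sum_(g <- W) \tr (invmx (rho g)) *: pact g f)).
    by rewrite gtr_sum; apply: eq_bigr => g _; rewrite gtrZ.
  move=> f _; rewrite scaler_sumr; under eq_bigr do
    rewrite mxE mul_mpolyC scalerA mulfV ?(refl_size_neq0 charK HW) // scale1r summxE.
  rewrite exchange_big /=; apply: eq_bigr => g _; rewrite /mxtrace scaler_suml.
  apply: eq_bigr => j _; rewrite tactE (bigD1 j) //= big1 ?addr0 => [|l lj].
    by rewrite !mxE !eqxx mulr1.
  by rewrite !mxE (negPf lj) andbF mulr0 pact_zero scaler0.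
rewrite (eq_gtr (O' := fun f => \sum_j \sum_i z i 0 j * b (f, j) i)); last first.
  move=> f _; apply: eq_bigr => j _; rewrite (bsum (f, j)) summxE.
  by apply: eq_bigr => i _; rewrite mxE mulrC.
rewrite gtr_sum; under eq_bigr do rewrite gtr_sum.
rewrite exchange_big mulr_sumr; apply: eq_bigr => i _ /=.
under eq_bigr do rewrite trb.
case: ifP => _; last by rewrite big1 ?mulr0.
rewrite -gtr_sum (eq_gtr (O' := wavg W)) => [|f _]; last exact: sumb.
by rewrite gtr_wavg mulrA mulfV ?mul1r // (refl_size_neq0 charK HW).
Qed.

End BasisTrace.

Lemma natr_inj_char0 (D : idomainType) : [pchar D] =i pred0 ->
  injective (fun n : nat => n%:R : D).
Proof.
move=> charD a b; wlog le : a b / (a <= b)%N.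
  by move=> H; have [/H h /h //|/ltnW/H h] := leqP a b; move/esym => /h ->.
move/eqP; rewrite /= eq_sym -subr_eq0 -natrB // ((pcharf0P D).1 charD) subn_eq0 => le'.
by apply/eqP; rewrite eqn_leq le.
Qed.

(** The points are the positive integers: infinitely many in characteristic 0, and nonzero, which
    [det1x_eigs] needs in order to divide by the point. *)
Lemma poly_eq_char0 (D : idomainType) (charD : [pchar D] =i pred0) (p q : {poly D}) :
  (forall n : nat, p.[n.+1%:R] = q.[n.+1%:R]) -> p = q.
Proof.
move=> pq; apply/eqP; rewrite -subr_eq0; apply: contraT => nz.
pose s : seq D := [seq i.+1%:R | i <- iota 0 (size (p - q))].
have us : uniq s.
  by rewrite map_inj_uniq ?iota_uniq // => i j /(natr_inj_char0 charD)[].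
have rs : all (root (p - q)) s.
  by apply/allP => x /mapP[i _ ->]; rewrite /root !hornerE pq subrr.
by have := max_poly_roots nz rs us; rewrite size_map size_iota ltnn.
Qed.

(** * Characteristic polynomials and eigenvalues *)

Section Eigenvalues.
Variables (K : closedFieldType) (charK : [pchar K] =i pred0).

Definition det1x n (B : 'M[K]_n) : {poly K} := \det (1%:M - 'X *: map_mx polyC B).

Lemma horner_det1x n (B : 'M[K]_n) c : (det1x B).[c] = \det (1%:M - c *: B).
Proof.
rewrite -[LHS]/(horner_eval c _) -det_map_mx; congr (\det _).
apply/matrixP => i j; rewrite !mxE /= /horner_eval -polyC_natr.
by rewrite !hornerE.
Qed.

Lemma horner_char_poly n (B : 'M[K]_n) c : (char_poly B).[c] = \det (c%:M - B).
Proof.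
rewrite -[LHS]/(horner_eval c _) -det_map_mx; congr (\det _).
apply/matrixP => i j; rewrite !mxE /= /horner_eval.
by case: eqP => _; rewrite ?mulr1n ?mulr0n !hornerE.
Qed.

Definition eigs n (B : 'M[K]_n) : seq K := sval (closed_field_poly_normal (char_poly B)).

Lemma char_poly_eigs n (B : 'M[K]_n) : char_poly B = \prod_(l <- eigs B) ('X - l%:P).
Proof.
rewrite /eigs; case: closed_field_poly_normal => s /= {1}->.
by rewrite (monicP (char_poly_monic B)) scale1r.
Qed.

Lemma size_eigs n (B : 'M[K]_n) : size (eigs B) = n.
Proof. by apply/eqP; rewrite -eqSS -(size_prod_XsubC _ id) -char_poly_eigs size_char_poly. Qed.

Lemma mxtrace_eigs n (B : 'M[K]_n) : \tr B = \sum_(l <- eigs B) l.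
Proof.
case: n B => [|n] B.
  by rewrite /mxtrace big_ord0; case: (eigs B) (size_eigs B) => // _; rewrite big_nil.
have := char_poly_trace B (ltn0Sn n); rewrite char_poly_eigs.
have := @coefPn_prod_XsubC _ (eigs B); rewrite size_eigs => /(_ isT) ->.
by move/oppr_inj.
Qed.

Lemma det_eigs n (B : 'M[K]_n) : \det B = \prod_(l <- eigs B) l.
Proof.
have := char_poly_det B; rewrite char_poly_eigs coef0_prod_XsubC size_eigs.
by move/(mulfI _) => <- //; rewrite signr_eq0.
Qed.

Lemma det1x_eigs n (B : 'M[K]_n) : det1x B = \prod_(l <- eigs B) (1 - l *: 'X).
Proof.
apply: (poly_eq_char0 charK) => i; set c := i.+1%:R.
have c0 : c != 0 by rewrite (pcharf0P K).1.
rewrite horner_det1x horner_prod.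
have -> : 1%:M - c *: B = c *: (c^-1%:M - B).
  by rewrite scalerBr scale_scalar_mx mulfV.
rewrite detZ -horner_char_poly char_poly_eigs horner_prod.
have -> : c ^+ n = \prod_(l <- eigs B) c.
  by rewrite big_const_seq count_predT size_eigs iter_mulr_1.
rewrite -big_split.
apply: eq_bigr => l _ /=; rewrite !hornerE mulrBr mulfV //; congr (_ - _).
by rewrite mulrC.
Qed.

(** A power of X - 1 and X^N - 1 both annihilate B. In characteristic 0 the root 1 of X^N - 1 is
    simple, so a Bezout relation shows that X - 1 itself annihilates B. *)
Lemma unipotent_finite_order n (B : 'M[K]_n) (N : nat) :
  (0 < N)%N -> B ^+ N = 1 -> all (pred1 1) (eigs B) -> B = 1%:M.
Proof.
case: n B => [|n] B N0 BN /all_pred1P eB; first by rewrite [B]flatmx0 [1%:M]flatmx0.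
pose p : {poly K} := 'X - 1; pose q : {poly K} := \sum_(i < N) 'X^i.
have pq : p * q = 'X^N - 1 by rewrite [RHS]subrX1.
have cop : coprimep (p ^+ n.+1) q.
  rewrite coprimep_expl // /p -[1]/(1%:P) coprimep_sym coprimep_XsubC.
  rewrite rootE /q horner_sum (eq_bigr (fun=> 1)) => [|i _]; last by rewrite hornerXn expr1n.
  by rewrite sumr_const card_ord ((pcharf0P K).1 charK) -lt0n.
have /Bezout_eq1_coprimepP[[u v] /= uv] := cop.
have CH : horner_mx B (p ^+ n.+1) = 0.
  have := Cayley_Hamilton B; rewrite char_poly_eigs eB size_eigs big_nseq.
  by rewrite iter_mulr_1 polyC1.
have pE : p = (p * u) * p ^+ n.+1 + v * (p * q).
  by rewrite -mulrA [v * _]mulrCA -mulrDr uv mulr1.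
have : horner_mx B p = 0.
  rewrite pE rmorphD /= [X in X + _]rmorphM /= CH mulr0 add0r rmorphM /= pq.
  by rewrite rmorphB /= rmorphXn /= horner_mx_X BN rmorph1 subrr mulr0.
by rewrite /p rmorphB /= horner_mx_X rmorph1 => /eqP; rewrite subr_eq0 => /eqP.
Qed.

End Eigenvalues.

(** * Expansion of the Molien series at x = 1 *)

Section Laurent.
Variables (K : closedFieldType) (charK : [pchar K] =i pred0) (r : nat).
Variables (W : seq 'M[K]_r) (HW : finite_reflection_group W).
Implicit Types g h : 'M[K]_r.

(** The Molien term 1 / det(1 - x g^-1) multiplied by the common denominator of all the terms. *)
Definition hatdet g : {poly K} := \prod_(h <- rem g W) det1x (invmx h).

Lemma gtr_hatdet b g : (0 < b)%N -> g \in W ->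
  eqm b (gtr_poly b (pact g) * \prod_(h <- W) det1x (invmx h)) (hatdet g).
Proof.
move=> b0 gW; rewrite (big_rem g gW) /= mulrA -[X in eqm _ _ X]mul1r.
by apply: eqmM => //; apply: gtr_subst.
Qed.

(** This is [winv_basis_trace] as a generating function: the Hilbert series of the free module of
    equivariants is that of the invariants times the sum of the x^w_i. *)
Lemma winv_basis_molien m (rho : 'M[K]_r -> 'M[K]_m) k z (w : 'I_k -> nat) :
    rho 1%:M = 1%:M ->
    (forall g h, g \in W -> h \in W -> rho (g *m h) = rho g *m rho h) ->
    winv_basis W rho z w ->
  (\sum_i 'X^(w i)) * \sum_(g <- W) hatdet g =
  \sum_(g <- W) (\tr (invmx (rho g)))%:P * hatdet g.
Proof.
move=> rho1 rhoM zb; apply: eqm_all => -[|b] //; set n := b.+1.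
pose D := \prod_(h <- W) det1x (invmx h).
have hD (c : 'M[K]_r -> {poly K}) : eqm n (\sum_(g <- W) c g * hatdet g)
    ((\sum_(g <- W) c g * gtr_poly n (pact g)) * D).
  rewrite mulr_suml !big_seq; apply: eqm_sum => g gW; rewrite -mulrA.
  by apply: eqmM => //; apply/eqm_sym/gtr_hatdet.
have := hD (fun=> 1); under eq_bigr do rewrite mul1r; under [X in X * D]eq_bigr do rewrite mul1r.
move=> h1; apply: eqm_trans (eqmM (@eqm_refl _ n _) h1) _.
apply: eqm_trans _ (eqm_sym (hD _)); rewrite mulrA; apply: eqmM => // d dn.
rewrite coef_sum; under [RHS]eq_bigr do rewrite coefCM coef_poly dn.
rewrite (winv_basis_trace charK HW rho1 rhoM zb) mulr_suml coef_sum.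
apply: eq_bigr => i _; rewrite coefXnM ltnNge; case: leqP => //= le.
rewrite coef_sum; apply: eq_bigr => g _; rewrite coef_poly (leq_ltn_trans _ dn) //.
exact: leq_subr.
Qed.

Lemma refl_finite_order g : g \in W -> exists2 N, (0 < N)%N & g ^+ N = 1.
Proof.
move=> gW; pose s := [seq g ^+ i | i <- iota 0 (size W).+1].
have sW : {subset s <= W}.
  move=> x /mapP[i _ ->]; elim: i => [|i IH]; first exact: (refl_one HW).
  by rewrite exprS; apply: (refl_mul HW).
have : ~~ uniq s.
  by apply/negP => /uniq_leq_size/(_ sW); rewrite size_map size_iota ltnn.
have sz : size s = (size W).+1 by rewrite size_map size_iota.
case/(uniqPn 0) => i [j []] ltij ltj; rewrite sz in ltj.
rewrite !(nth_map 0%N) ?size_iota ?(ltn_trans ltij) // !nth_iota ?(ltn_trans ltij) //.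
rewrite !add0n -(subnK (ltnW ltij)) exprD => e; exists (j - i)%N; first by rewrite subn_gt0.
have giU : g ^+ i \in unitmx.
  by apply: (refl_unit HW); apply: sW; apply/mapP; exists i; rewrite // mem_iota add0n (ltn_trans ltij).
apply: (can_inj (mulmxK giU)); rewrite -[RHS]/(1 * g ^+ i) mul1r.
exact/esym.
Qed.

Lemma eigs1 : all (pred1 1) (eigs (1%:M : 'M[K]_r)).
Proof.
apply/allP => l; rewrite -root_prod_XsubC -char_poly_eigs /root horner_char_poly.
by rewrite -raddfB /= det_scalar expf_eq0 subr_eq0 => /andP[].
Qed.

Definition eigs_ne1 g : seq K := [seq l <- eigs (invmx g) | l != 1].

Definition codim g := size (eigs_ne1 g).

Definition regdet g : {poly K} := \prod_(l <- eigs_ne1 g) (1 - l *: 'X).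

(** The factorisation det(1 - x g^-1) = (1 - x)^(r - codim g) regdet(g), with the codimension moved
    to the left to avoid a subtraction. *)
Lemma det1x_regdet g :
  (1 - 'X) ^+ codim g * det1x (invmx g) = (1 - 'X) ^+ r * regdet g.
Proof.
rewrite (det1x_eigs charK) (bigID (pred1 1)) /= -[in RHS](size_eigs (invmx g)).
rewrite -(count_predC (pred1 1)) addnC exprD /codim size_filter.
rewrite -!mulrA; congr (_ * _); rewrite /regdet big_filter; congr (_ * _).
rewrite (eq_bigr (fun=> 1 - 'X)) => [|l /eqP ->]; last by rewrite scale1r.
by rewrite -big_filter big_const_seq count_predT iter_mulr_1 size_filter.
Qed.

Lemma regdet1 g : (regdet g).[1] != 0.
Proof.
rewrite /regdet horner_prod prodf_seq_neq0; apply/allP => l /=.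
by rewrite mem_filter !hornerE subr_eq0 eq_sym => /andP[].
Qed.

Lemma codim1 : codim 1%:M = 0%N.
Proof.
rewrite /codim /eigs_ne1 invmx1 size_filter; apply/eqP; rewrite -leqn0 leqNgt -has_count.
by apply/hasPn => l /(allP eigs1) /= ->.
Qed.

Lemma codim_gt0 g : g \in W -> g != 1%:M -> (0 < codim g)%N.
Proof.
move=> gW; apply: contraNT; rewrite -eqn0Ngt /codim size_filter -leqn0 leqNgt -has_count.
move/hasPn => eg; have [N N0 gN] := refl_finite_order (refl_inv HW gW).
rewrite -[g]invmxK (unipotent_finite_order charK N0 gN) ?invmx1 //.
by apply/allP => l /eg; rewrite negbK.
Qed.

Lemma reflection_trace_det g : (codim g < 2)%N ->
  \tr (invmx g) - r%:R = \det (invmx g) - 1.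
Proof.
move=> c2; have -> : r%:R = \sum_(l <- eigs (invmx g)) 1 :> K.
  by rewrite big_const_seq count_predT iter_addr_0 size_eigs.
rewrite mxtrace_eigs det_eigs -sumrB (bigID (pred1 1)) /= big1 => [|l /eqP ->]; last by rewrite subrr.
rewrite [in RHS](bigID (pred1 1)) /= [X in X * _]big1 => [|l /eqP //].
rewrite add0r mul1r.
rewrite -[LHS]big_filter -[X in _ = X - _]big_filter -/(eigs_ne1 g); move: c2; rewrite /codim.
case: (eigs_ne1 g) => [|l [|//]] _; first by rewrite !big_nil subrr.
by rewrite !big_seq1.
Qed.

(* Up to a factor independent of g, this is (1 - x)^r / det(1 - x g^-1); its value and
   derivative at 1 give the two leading Laurent coefficients of the Molien series there. *)
Definition reghat g : {poly K} := (1 - 'X) ^+ codim g * \prod_(h <- rem g W) regdet h.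

Lemma winv_basis_reghat m (rho : 'M[K]_r -> 'M[K]_m) k z (w : 'I_k -> nat) :
    rho 1%:M = 1%:M ->
    (forall g h, g \in W -> h \in W -> rho (g *m h) = rho g *m rho h) ->
    winv_basis W rho z w ->
  (\sum_i 'X^(w i)) * \sum_(g <- W) reghat g =
  \sum_(g <- W) (\tr (invmx (rho g)))%:P * reghat g.
Proof.
move=> rho1 rhoM zb; have X1 : 1 - 'X != 0 :> {poly K}.
  by rewrite -opprB oppr_eq0 -polyC1 polyXsubC_eq0.
pose A := \prod_(h <- W) (1 - 'X : {poly K}) ^+ codim h.
pose B := \prod_(h <- W) (1 - 'X : {poly K}) ^+ r.
have regE g : g \in W -> (A * (1 - 'X) ^+ r) * hatdet g = B * reghat g.
  move=> gW; rewrite /A /B /hatdet /reghat !(big_rem g gW) /=.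
  rewrite [RHS]mulrACA -[X in _ = _ * X]big_split /=.
  under [in RHS]eq_bigr do rewrite -det1x_regdet.
  by rewrite big_split /= [RHS]mulrA; congr (_ * _); rewrite mulrAC [X in _ = X * _]mulrC.
have A0 : A * (1 - 'X) ^+ r != 0.
  by rewrite mulf_neq0 ?expf_neq0 // prodf_seq_neq0; apply/allP => g _; rewrite expf_neq0.
have B0 : B != 0 by rewrite prodf_seq_neq0; apply/allP => g _; rewrite expf_neq0.
have sumE (c : 'M[K]_r -> {poly K}) :
    B * \sum_(g <- W) c g * reghat g = (A * (1 - 'X) ^+ r) * \sum_(g <- W) c g * hatdet g.
  rewrite !mulr_sumr !big_seq; apply: eq_bigr => g gW.
  by rewrite mulrCA -regE // mulrCA.
apply: (mulfI B0); rewrite sumE -(winv_basis_molien rho1 rhoM zb) mulrCA.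
have := sumE (fun=> 1); under eq_bigr do rewrite mul1r.
under [in RHS]eq_bigr do rewrite mul1r.
by move=> ->; rewrite mulrCA.
Qed.

Definition lau_coef g : K := (reghat g)^`().[1].

Lemma reghat_at1 g : g \in W -> g != 1%:M -> (reghat g).[1] = 0.
Proof.
move=> gW g1; rewrite /reghat -(prednK (codim_gt0 gW g1)) exprS !hornerE.
by rewrite subrr !mul0r.
Qed.

Lemma reghat1_neq0 : (reghat 1%:M).[1] != 0.
Proof.
rewrite /reghat codim1 expr0 mul1r horner_prod prodf_seq_neq0; apply/allP => h _.
exact: regdet1.
Qed.

Lemma lau_coef_eq0 g : (2 <= codim g)%N -> lau_coef g = 0.
Proof.
move=> c2; rewrite /lau_coef /reghat -(subnKC c2) exprD expr2 -[_ * _ * _ * _]mulrA.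
set p := 1 - 'X; set q := _ ^+ _ * _; have p1 : p.[1] = 0 by rewrite !hornerE subrr.
move: p q p1 => p q p1.
by rewrite !derivM !(hornerD, hornerM) p1 !(mul0r, mulr0, addr0).
Qed.

(** At x = 1 only the identity has a nonzero [reghat], so k equals the trace of [rho 1%:M], that is
    m. *)
Lemma winv_basis_size m (rho : 'M[K]_r -> 'M[K]_m) k z (w : 'I_k -> nat) :
    rho 1%:M = 1%:M ->
    (forall g h, g \in W -> h \in W -> rho (g *m h) = rho g *m rho h) ->
    winv_basis W rho z w -> k = m.
Proof.
move=> rho1 rhoM zb; have := congr1 (horner^~ 1) (winv_basis_reghat rho1 rhoM zb).
rewrite /= hornerM !horner_sum.
have one (c : 'M[K]_r -> K) : \sum_(g <- W) c g * (reghat g).[1] = c 1%:M * (reghat 1%:M).[1].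
  rewrite (big_rem _ (refl_one HW)) /= big_seq big1 ?addr0 // => g.
  have uW : uniq W by case: HW.
  by rewrite mem_rem_uniq // inE => /andP[g1 gW]; rewrite reghat_at1 ?mulr0.
under eq_bigr do rewrite hornerXn expr1n.
under [X in _ = X]eq_bigr do rewrite hornerM hornerC.
have one1 : \sum_(g <- W) (reghat g).[1] = (reghat 1%:M).[1].
  have := one (fun=> 1); rewrite mul1r => <-.
  by apply: eq_bigr => g _; rewrite mul1r.
rewrite one one1 rho1 invmx1 mxtrace1 sumr_const card_ord => /(mulIf reghat1_neq0).
exact: (natr_inj_char0 charK).
Qed.

(** First derivative at x = 1 of [winv_basis_reghat]. The sum of the degrees is thus determined by
    the character of [rho], and [lau_coef_eq0] restricts the sum to elements of codimension at most
    1. *)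
Lemma winv_basis_degree m (rho : 'M[K]_r -> 'M[K]_m) k z (w : 'I_k -> nat) :
    rho 1%:M = 1%:M ->
    (forall g h, g \in W -> h \in W -> rho (g *m h) = rho g *m rho h) ->
    winv_basis W rho z w ->
  (\sum_i w i)%:R * (reghat 1%:M).[1] =
  \sum_(g <- W) (\tr (invmx (rho g)) - m%:R) * lau_coef g.
Proof.
move=> rho1 rhoM zb; have km := winv_basis_size rho1 rhoM zb.
have := congr1 (fun p => p^`().[1]) (winv_basis_reghat rho1 rhoM zb).
rewrite /= derivM hornerD [X in X + _]hornerM [X in _ + X = _]hornerM.
rewrite !raddf_sum !horner_sum /=.
under eq_bigr do rewrite derivXn hornerMn hornerXn expr1n.
under [X in _ + X * _]eq_bigr do rewrite hornerXn expr1n.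
under [X in _ = X]eq_bigr do rewrite derivM derivC mul0r add0r hornerM hornerC.
have kmR : k%:R = m%:R :> K by rewrite km.
rewrite sumr_const card_ord kmR -natr_sum.
have -> : \sum_(g <- W) (reghat g).[1] = (reghat 1%:M).[1].
  rewrite (big_rem _ (refl_one HW)) /= big_seq big1 ?addr0 // => g.
  have uW : uniq W by case: HW.
  by rewrite mem_rem_uniq // inE => /andP[g1 gW]; rewrite reghat_at1.
under [X in _ -> _ = X]eq_bigr do rewrite mulrBl.
by rewrite sumrB -mulr_sumr => <-; rewrite addrK.
Qed.

(** Makes N(M) well defined: the basis that witnesses it in the hypothesis need not be the
    eigenbasis of the conclusion. *)
Lemma winv_basis_degree_unique m (rho : 'M[K]_r -> 'M[K]_m) k z (w : 'I_k -> nat)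
    k' z' (w' : 'I_k' -> nat) :
    rho 1%:M = 1%:M ->
    (forall g h, g \in W -> h \in W -> rho (g *m h) = rho g *m rho h) ->
    winv_basis W rho z w -> winv_basis W rho z' w' ->
  (\sum_i w i = \sum_i w' i)%N.
Proof.
move=> rho1 rhoM zb zb'; apply/(natr_inj_char0 charK)/(mulIf reghat1_neq0).
by rewrite (winv_basis_degree rho1 rhoM zb) (winv_basis_degree rho1 rhoM zb').
Qed.

(** In the two degree formulas only elements of codimension at most 1 contribute, and there trace -
    r and det - 1 agree by [reflection_trace_det]. *)
Lemma winv_basis_degree_det k z (w : 'I_k -> nat) k' z' (w' : 'I_k' -> nat) :
  winv_basis W (fun g => g) z w -> winv_basis W (fun g => (\det g)%:M : 'M_1) z' w' ->
  (\sum_i w i = \sum_i w' i)%N.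
Proof.
move=> zb zb'; have detM g h : g \in W -> h \in W ->
    (\det (g *m h))%:M = (\det g)%:M *m (\det h)%:M :> 'M[K]_1.
  by move=> _ _; rewrite det_mulmx scalar_mxM.
have det1' : (\det (1%:M : 'M[K]_r))%:M = 1%:M :> 'M[K]_1 by rewrite det1.
have e1 := winv_basis_degree (erefl _) (fun _ _ _ _ => erefl) zb.
have e2 := winv_basis_degree det1' detM zb'.
have : (\sum_i w i)%:R * (reghat 1%:M).[1] = (\sum_i w' i)%:R * (reghat 1%:M).[1].
  rewrite e1 e2; apply: eq_bigr => g _.
  have [c2|c2] := ltnP (codim g) 2; last by rewrite lau_coef_eq0 ?mulr0.
  congr (_ * _); rewrite invmx_scalar mxtrace_scalar mulr1n reflection_trace_det //.
  by rewrite det_inv.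
by move/(mulIf reghat1_neq0)/(natr_inj_char0 charK).
Qed.

End Laurent.

Lemma mulmx_sub_scale (R : comNzRingType) n (X Y Z : 'M[R]_n) (y : R) :
  X *m Z = Y -> X *m (1%:M - y *: Z) = X - y *: Y.
Proof. by move=> <-; rewrite mulmxBr mulmx1 scalemxAr. Qed.

(** * Determinants of matrices with homogeneous entries *)

Section HomogeneousDeterminant.
Variables (K : fieldType) (r m : nat).
Local Notation S := {mpoly K[r]}.

Lemma homog_prod I (s : seq I) (P : pred I) (F : I -> S) (d : I -> nat) :
  (forall i, P i -> F i \is (d i).-homog) ->
  \prod_(i <- s | P i) F i \is (\sum_(i <- s | P i) d i)%N.-homog.
Proof.
move=> Fh; elim/big_rec2: _ => [|i p e Pi IH]; first exact: dhomog1.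
by apply: dhomogM IH; apply: Fh.
Qed.

Lemma homog_sign d (b : bool) (f : S) : f \is d.-homog -> (-1) ^+ b * f \is d.-homog.
Proof. by case: b => fh; rewrite ?expr1 ?expr0 ?mulN1r ?mul1r ?rpredN. Qed.

(** In the permutation expansion a term either has a vanishing factor or has degree the sum of the
    w_i - w_s(i), which is 0. The determinant is therefore a constant, computed on constant
    terms. *)
Lemma det_graded_const (w : 'I_m -> nat) (M : 'M[S]_m) :
    (forall i j, (w j <= w i)%N -> M i j \is (w i - w j).-homog) ->
    (forall i j, (w i < w j)%N -> M i j = 0) ->
  \det M = (\det (map_mx (mcoeff 0%MM) M))%:MP.
Proof.
move=> Mh M0; rewrite det_map_mx; apply: homog0C; apply: rpred_sum => s _.
apply: homog_sign; have [|] := boolP [exists i, (w i < w (s i))%N].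
  by case/existsP => i lt; rewrite (bigD1 i) //= M0 // mul0r; apply: rpred0.
rewrite negb_exists => /forallP le; have {}le i : (w (s i) <= w i)%N by rewrite leqNgt.
have sw : (\sum_i w (s i) = \sum_i w i)%N by rewrite [RHS](reindex_inj (@perm_inj _ s)).
have e0 : (\sum_i (w i - w (s i)) = 0)%N by rewrite sumnB // sw subnn.
by have := homog_prod (index_enum _) (P := xpredT) (fun i _ => Mh _ _ (le i)); rewrite e0.
Qed.

End HomogeneousDeterminant.

(** * The trace identity on the coset of gamma *)

Section MainIdentity.
Variables (K : fieldType) (charK : [pchar K] =i pred0) (r : nat).
Variables (W : seq 'M[K]_r) (HW : finite_reflection_group W).
Variable m : nat.
Local Notation S := {mpoly K[r]}.
Variable rho : 'M[K]_r -> 'M[K]_m.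
Hypothesis rho1 : rho 1%:M = 1%:M.
Hypothesis rhoM : forall g h, g \in W -> h \in W -> rho (g *m h) = rho g *m rho h.
Variables (z : 'I_m -> 'rV[S]_m) (w : 'I_m -> nat).
Hypothesis zbasis : winv_basis W rho z w.
Local Notation Phi := (\matrix_i z i : 'M[S]_m).
Local Notation cmx := (map_mx (@mpolyC r K)).
Hypothesis semi_dvd : forall h : S, (forall g, g \in W -> pact g h = \det (rho g) *: h) ->
  exists q, h = q * \det Phi.
Variables (gamma : 'M[K]_r) (eps : 'I_m -> K) (C : 'M[S]_m).
Hypothesis gammaU : gamma \in unitmx.
Hypothesis rho_gammaU : rho gamma \in unitmx.
Hypothesis rho_gammaM : forall g, g \in W -> rho (gamma *m g) = rho gamma *m rho g.
Hypothesis gammaC : forall i, tact rho gamma (z i) = \sum_j C i j *: z j.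
Hypothesis C_homog : forall i j, (w j <= w i)%N -> C i j \is (w i - w j).-homog.
Hypothesis C_zero : forall i j, (w i < w j)%N -> C i j = 0.
Hypothesis C_const : forall i j, (C i j)@_0%MM = eps i *+ (i == j).

Implicit Types (I : {set 'I_m}) (s : 'S_m).
Let Q := \det Phi.

Lemma pact_Phi g : g \in W -> map_mx (pact g) Phi = Phi *m cmx (rho g).
Proof.
move=> gW; case: zbasis => iz _ _ _; have rU := rho_unit HW rho1 rhoM gW.
have E : map_mx (pact g) Phi *m cmx (invmx (rho g)) = Phi.
  apply/row_matrixP => i; rewrite row_mul rowK -[RHS](iz i g gW) /tact.
  by congr (_ *m _); apply/rowP => j; rewrite !mxE.
by rewrite -[X in _ = X *m _]E -mulmxA -map_mxM mulVmx // map_mx1 mulmx1.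
Qed.

Lemma pact_gamma_Phi : map_mx (pact gamma) Phi = C *m Phi *m cmx (rho gamma).
Proof.
have E : map_mx (pact gamma) Phi *m cmx (invmx (rho gamma)) = C *m Phi.
  apply/row_matrixP => i; rewrite !row_mul [row i C *m _]mulmx_sum_row.
  under [RHS]eq_bigr do rewrite rowK mxE.
  rewrite -gammaC /tact; congr (_ *m _).
  by apply/rowP => j; rewrite !mxE.
by rewrite -E -mulmxA -map_mxM mulVmx // map_mx1 mulmx1.
Qed.

Lemma det_Phi_neq0 : Q != 0.
Proof.
case: zbasis => iz _ _ fz; apply: free_rows_det_neq0 => v.
exact: (free_matrix charK HW iz fz).
Qed.

Lemma det_Phi_homog : Q \is (\sum_i w i)%N.-homog.
Proof.
case: zbasis => _ zh _ _; apply: rpred_sum => s _.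
by apply: homog_sign; apply: homog_prod => i _; rewrite mxE; apply: zh.
Qed.

Lemma pact_det_Phi g : g \in W -> pact g Q = \det (rho g) *: Q.
Proof.
move=> gW; rewrite -det_map_mx pact_Phi // det_mulmx det_map_mx /=.
by rewrite mulrC mul_mpolyC.
Qed.

(** |W| times the projector onto the det(rho)-semi-invariants; by [semi_dvd] all its values are
    multiples of [Q]. *)
Definition chi_sum (f : S) : S := \sum_(g <- W) (\det (rho g))^-1 *: pact g f.

Lemma det_rho_neq0 g : g \in W -> \det (rho g) != 0.
Proof. by move=> gW; rewrite -unitfE -unitmxE (rho_unit HW rho1 rhoM). Qed.

Lemma chi_sum_semi f g : g \in W -> pact g (chi_sum f) = \det (rho g) *: chi_sum f.
Proof.
move=> gW; rewrite /chi_sum pact_sum scaler_sumr.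
rewrite -[RHS](refl_sum_mull HW _ gW) !big_seq; apply: eq_bigr => h hW.
rewrite pact_scale rhoM // det_mulmx pactM ?(refl_unit HW) // scalerA invfM mulrA.
by rewrite mulfV ?det_rho_neq0 // mul1r.
Qed.

Lemma chi_sum_linear : linear chi_sum.
Proof.
move=> c p q; rewrite /chi_sum scaler_sumr -big_split; apply: eq_bigr => g _ /=.
by rewrite pact_add pact_scale scalerDr !scalerA mulrC.
Qed.

Lemma chi_sum_homog d f : f \is d.-homog -> chi_sum f \is d.-homog.
Proof. by move=> fh; apply: rpred_sum => g _; apply: rpredZ; apply: pact_homog. Qed.

Lemma det_expand_sub (R : comNzRingType) (X Y : 'M[R]_m) (y : R) :
  \det (X - y *: Y) = \sum_(I : {set 'I_m}) \sum_(s : 'S_m)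
    ((- y) ^+ #|I| * (-1) ^+ s) * ((\prod_(i in I) Y i (s i)) * \prod_(i in ~: I) X i (s i)).
Proof.
rewrite /determinant; under eq_bigr => s _.
  under eq_bigr => i _ do rewrite !mxE addrC -mulNr.
  rewrite bigA_distr mulr_sumr.
over.
rewrite exchange_big; apply: eq_bigr => I _; apply: eq_bigr => s _ /=.
rewrite -mulrA [RHS]mulrCA; congr (_ * _); rewrite (bigID (fun i => i \in (I : {set 'I_m}))) /=.
rewrite (eq_bigr (fun i => - y * Y i (s i))) => [|i ->//]; rewrite big_split /=.
rewrite prodr_const mulrA; congr (_ * _); apply: eq_big => [i|i /negPf -> //].
by rewrite inE.
Qed.

(** The mixed matrix is CI Phi, where CI has the rows of C on I and identity rows elsewhere. CI is
    still graded, so its determinant is the product of its diagonal constant terms. *)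
Lemma det_mix (I : {set 'I_m}) : \det (\matrix_(i, j) (if i \in I then (C *m Phi) i j else Phi i j)) =
  (\prod_(i in I) eps i)%:MP * Q.
Proof.
pose CI : 'M[S]_m := \matrix_(i, j) (if i \in I then C i j else (i == j)%:R).
have -> : \matrix_(i, j) (if i \in I then (C *m Phi) i j else Phi i j) = CI *m Phi.
  apply/matrixP => i j; rewrite !mxE; case: ifP => iI.
    by apply: eq_bigr => k _; rewrite !mxE iI.
  rewrite (bigD1 i) //= !mxE iI eqxx mul1r big1 ?addr0 // => k ki.
  by rewrite !mxE iI eq_sym (negPf ki) mul0r.
rewrite det_mulmx; congr (_ * _).
rewrite (@det_graded_const _ _ _ w) => [|i j le|i j lt].
- congr (_%:MP); have -> : map_mx (mcoeff 0%MM) CI =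
      diag_mx (\row_i (if i \in I then eps i else 1)).
    apply/matrixP => i j; rewrite !mxE; case: ifP => iI; first by rewrite C_const.
    by case: eqP => _; rewrite ?mcoeff1 ?eqxx ?mcoeff0.
  rewrite det_diag [RHS]big_mkcond; apply: eq_bigr => i _; rewrite mxE //.
- rewrite mxE; case: ifP => _; first exact: C_homog.
  by case: eqP => [->|_]; rewrite ?subnn; [apply: dhomog1|apply: rpred0].
- rewrite mxE; case: ifP => _; first exact: C_zero.
  by case: eqP lt => // ->; rewrite ltnn.
Qed.

Let wI (I : {set 'I_m}) := (\sum_(i in I) w i)%N.
Let uI (I : {set 'I_m}) (s : 'S_m) : S := \prod_(i in I) (C *m Phi) i (s i).
Let vI (I : {set 'I_m}) (s : 'S_m) : S := \prod_(i in ~: I) Phi i (s i).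

Lemma uI_homog I s : uI I s \is (wI I).-homog.
Proof.
case: zbasis => _ zh _ _; apply: homog_prod => i _; rewrite mxE.
apply: rpred_sum => j _; rewrite mxE; have [le|lt] := leqP (w j) (w i).
  by have := dhomogM (C_homog le) (zh j (s i)); rewrite subnK.
by rewrite C_zero // mul0r; apply: rpred0.
Qed.

Lemma vI_homog I s : vI I s \is (wI (~: I)).-homog.
Proof. by case: zbasis => _ zh _ _; apply: homog_prod => i _; rewrite mxE; apply: zh. Qed.

Lemma wI_compl I : (wI I + wI (~: I) = \sum_i w i)%N.
Proof.
rewrite /wI [RHS](bigID (fun i => i \in I)) /=; congr (_ + _)%N.
by apply: eq_bigl => i; rewrite inE.
Qed.

(** Proved after multiplication by gamma(Q), which is nonzero. For A = gamma g one has A(Q) =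
    det(rho g) gamma(Q), so passing from A(Q) to gamma(Q) costs the factor det(rho g)^-1, exactly
    the weight in [chi_sum]. The rows outside I contribute A(v). *)
Lemma gamma_operator_expand (q : S -> S) (y : K) (f : S) :
    (forall h, chi_sum h = q h * Q) ->
  \sum_(g <- W) \det (1%:M - y *: invmx (rho (gamma *m g))) *: pact (gamma *m g) f =
  \sum_(I : {set 'I_m}) \sum_(s : 'S_m) ((- y) ^+ #|I| * (-1) ^+ s) *:
     (uI I s * pact gamma (q (vI I s * f))).
Proof.
move=> qE; have gQ0 : pact gamma Q != 0 by rewrite pact_eq0 ?det_Phi_neq0.
apply: (mulfI gQ0); rewrite !mulr_sumr.
have termE g : g \in W -> pact gamma Q *
     (\det (1%:M - y *: invmx (rho (gamma *m g))) *: pact (gamma *m g) f) =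
   \sum_(I : {set 'I_m}) \sum_(s : 'S_m) ((- y) ^+ #|I| * (-1) ^+ s) *:
     (uI I s * pact gamma ((\det (rho g))^-1 *: pact g (vI I s * f))).
  move=> gW; have gU := refl_unit HW gW; set A := gamma *m g.
  have pA p : pact A p = pact gamma (pact g p) by rewrite pactM.
  have APhi : map_mx (pact A) Phi = C *m Phi *m cmx (rho A).
    rewrite rho_gammaM // map_mxM mulmxA -pact_gamma_Phi.
    have -> : map_mx (pact A) Phi = map_mx (pact gamma) (map_mx (pact g) Phi).
      by apply/matrixP => i j; rewrite !mxE pA.
    rewrite pact_Phi // map_mxM; congr (_ *m _).
    by apply/matrixP => i j; rewrite !mxE /= pactC.
  have rAU : rho A \in unitmx by rewrite rho_gammaM // unitmx_mul rho_gammaU (rho_unit HW rho1 rhoM).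
  have detE : \det (1%:M - y *: invmx (rho A)) *: pact A Q =
      \det (map_mx (pact A) Phi - y%:MP *: (C *m Phi)).
    have E1 : cmx (1%:M - y *: invmx (rho A)) = 1%:M - y%:MP *: cmx (invmx (rho A)).
      apply/matrixP => i j; rewrite !mxE mpolyCB mpolyCM; congr (_ - _).
      by case: eqP => _; rewrite ?mpolyC1 ?mpolyC0.
    have E2 : map_mx (pact A) Phi *m cmx (invmx (rho A)) = C *m Phi.
      by rewrite APhi -mulmxA -map_mxM (mulmxV rAU) map_mx1 mulmx1.
    have E3 : map_mx (pact A) Phi *m cmx (1%:M - y *: invmx (rho A)) =
        map_mx (pact A) Phi - y%:MP *: (C *m Phi).
      by rewrite E1; apply: mulmx_sub_scale.
    rewrite -E3 det_mulmx !det_map_mx /= mulrC mul_mpolyC //.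
  have AQ : pact A Q = \det (rho g) *: pact gamma Q by rewrite pA pact_det_Phi // pact_scale.
  have -> : pact gamma Q * (\det (1%:M - y *: invmx (rho A)) *: pact A f) =
      (\det (rho g))^-1 *: ((\det (1%:M - y *: invmx (rho A)) *: pact A Q) * pact A f).
    rewrite AQ -!scalerAl -scalerAr !scalerA mulrCA mulVf ?mulr1 // det_rho_neq0 //.
  rewrite detE det_expand_sub mulr_suml scaler_sumr; apply: eq_bigr => I _.
  rewrite mulr_suml scaler_sumr; apply: eq_bigr => s _.
  have -> : \prod_(i in ~: I) (map_mx (pact A) Phi) i (s i) = pact A (vI I s).
    by rewrite /vI rmorph_prod; apply: eq_bigr => i _; rewrite [LHS]mxE.
  rewrite pact_scale -pA pact_mul -/(uI I s) -scalerAr scalerA [_ * _^-1]mulrC -scalerA.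
  congr (_ *: _); rewrite -mpolyCN -rmorphXn /= -[RHS]mul_mpolyC mpolyCM -!mulrA.
  by congr (_ * _); rewrite rmorph_sign !mulrA.
rewrite big_seq (eq_bigr _ termE) -big_seq exchange_big; apply: eq_bigr => I _ /=.
rewrite exchange_big mulr_sumr; apply: eq_bigr => s _ /=.
rewrite -scaler_sumr -mulr_sumr -pact_sum -/(chi_sum _) qE pact_mul -scalerAr.
by rewrite [X in _ *: X]mulrA [X in _ *: X]mulrC.
Qed.

(* Write det(1 - y rho(A)^-1) A(Q) = det(A(Phi) - y C Phi) for A = gamma g and Q = det Phi, and
   expand by rows. After averaging over g every summand is an operator f |-> u gamma(q(v f)),
   where u and v are products of entries; by cyclicity it has the same trace as
   f |-> gamma(q(v u f)), and the products v u add up to a constant multiple of Q. *)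
Lemma gamma_trace (y : K) d :
  \sum_(g <- W) \det (1%:M - y *: invmx (rho (gamma *m g))) * gtr d (pact (gamma *m g)) =
  \sum_(I : {set 'I_m}) (- y) ^+ #|I| * (\prod_(i in I) eps i) *
    (if (\sum_(i in I) w i <= d)%N
     then \sum_(g <- W) gtr (d - \sum_(i in I) w i) (pact (gamma *m g)) else 0).
Proof.
have [q qE] : exists q : S -> S, forall h, chi_sum h = q h * Q.
  apply: (functional_choice (fun h qh => chi_sum h = qh * Q)) => h.
  by apply: semi_dvd => g; apply: chi_sum_semi.
have Q0 := det_Phi_neq0.
have qlin : linear q.
  move=> c p p'; apply: (mulIf Q0); rewrite -qE chi_sum_linear !qE.
  by rewrite mulrDl scalerAl.
under eq_bigr do rewrite -gtrZ.
rewrite -gtr_sum (eq_gtr (O' := fun f => \sum_(I : {set 'I_m}) \sum_(s : 'S_m)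
   ((- y) ^+ #|I| * (-1) ^+ s) *: (uI I s * pact gamma (q (vI I s * f))))); last first.
  by move=> f _; apply: gamma_operator_expand.
rewrite gtr_sum; apply: eq_bigr => I _; rewrite gtr_sum -/(wI I).
have ulin s : linear (fun f => uI I s * f) by move=> c p p'; rewrite mulrDr scalerAr.
have vlin s : linear (fun f => pact gamma (q (vI I s * f))).
  by move=> c p p'; rewrite mulrDr -scalerAr qlin pact_add pact_scale.
(* Multiplication by v raises degrees by w(~: I) and division by Q lowers them by the sum of all w,
   so the composite lowers degrees by w(I), and vanishes when d < w(I). *)
have qh s f : f \is d.-homog -> q (vI I s * f) =
    if (wI I <= d)%N then pihomog mdeg (d - wI I) (q (vI I s * f)) else 0.
  move=> fh; apply: (mulIf Q0).
  have vfh := dhomogM (vI_homog I s) fh.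
  have e := pihomog_dE (chi_sum_homog vfh); rewrite qE in e; rewrite -{1}e.
  have N := wI_compl I; case: leqP => le.
    have -> : (wI (~: I) + d = d - wI I + \sum_i w i)%N by rewrite -N; lia.
    by rewrite (pihomog_mulr _ _ det_Phi_homog).
  by rewrite mul0r (pihomog_mulr_lt _ det_Phi_homog) //; lia.
have trs s : gtr d (fun f => uI I s * pact gamma (q (vI I s * f))) =
   if (wI I <= d)%N then gtr (d - wI I) (fun f => pact gamma (q (vI I s * (uI I s * f)))) else 0.
  case: leqP => le; last first.
    apply: big1 => n /eqP nd; have Xh : 'X_[K, n] \is d.-homog by rewrite dhomogX /= nd.
    by rewrite (qh s _ Xh) leqNgt le pact_zero mulr0 mcoeff0.
  apply: (gtr_cyclic (ulin s) (vlin s)) => f fh.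
    by rewrite (qh s _ fh) le; apply/pact_homog/pihomogP.
  by have := dhomogM (uI_homog I s) fh; rewrite subnKC.
pose O s f := pact gamma (q (vI I s * (uI I s * f))).
transitivity (\sum_(s : 'S_m) (- y) ^+ #|I| *
    (if (wI I <= d)%N then gtr (d - wI I) (fun f => (-1) ^+ s *: O s f) else 0)).
  apply: eq_bigr => s _; rewrite (gtrZ d _ (fun f => uI I s * pact gamma (q (vI I s * f)))).
  rewrite trs -mulrA; congr (_ * _); case: ifP => _; last by rewrite mulr0.
  by rewrite (gtrZ _ _ (O s)).
rewrite -mulr_sumr -[RHS]mulrA; congr (_ * _).
case: ifP => le; last by rewrite mulr0 big1.
rewrite -gtr_sum -gtr_sum -gtrZ; apply: eq_gtr => f _; rewrite /O.
pose mQ := GRing.isLinear.Build _ _ _ _ q qlin; pose q' : {linear S -> S} := HB.pack q mQ.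
have -> : \sum_(s : 'S_m) (-1) ^+ s *: pact gamma (q (vI I s * (uI I s * f))) =
   pact gamma (q' (\sum_(s : 'S_m) (-1) ^+ s *: (vI I s * (uI I s * f)))).
  rewrite linear_sum pact_sum; apply: eq_bigr => s _.
  by rewrite linearZ pact_scale.
have -> : \sum_(s : 'S_m) (-1) ^+ s *: (vI I s * (uI I s * f)) =
    (\prod_(i in I) eps i) *: (f * Q).
  rewrite -mul_mpolyC mulrCA -det_mix mulrC /determinant mulr_suml; apply: eq_bigr => s _.
  have -> : \prod_i (\matrix_(i, j) (if i \in I then (C *m Phi) i j else Phi i j)) i (s i) =
      uI I s * vI I s.
    rewrite (bigID (fun i => i \in I)) /=; congr (_ * _).
      by apply: eq_bigr => i iI; rewrite [LHS]mxE iI.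
    apply: eq_big => [i|i /negPf iI]; first by rewrite inE.
    by rewrite [LHS]mxE iI.
  by rewrite -[LHS]mul_mpolyC rmorph_sign -!mulrA; congr (_ * _); apply: mulrCA.
rewrite linearZ pact_scale; congr (_ *: _); rewrite -[q' _]/(q _).
(* The semi-invariance of Q cancels the character in [chi_sum (f * Q)], leaving the plain sum over
   W. *)
have -> : q (f * Q) = \sum_(g <- W) pact g f.
  apply: (mulIf Q0); rewrite -qE /chi_sum mulr_suml !big_seq; apply: eq_bigr => g gW.
  by rewrite pact_mul pact_det_Phi // -scalerAr scalerA mulVf ?scale1r // det_rho_neq0.
rewrite pact_sum !big_seq; apply: eq_bigr => g gW.
by rewrite pactM // (refl_unit HW).
Qed.

Definition twisted_hatdet g : {poly K} :=
  \prod_(h <- rem g W) \det (1%:M - 'X *: map_mx polyC (invmx (gamma *m h))).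

Lemma gtr_twisted_hatdet b g : (0 < b)%N -> g \in W ->
  eqm b (gtr_poly b (pact (gamma *m g)) *
           \prod_(h <- W) \det (1%:M - 'X *: map_mx polyC (invmx (gamma *m h))))
        (twisted_hatdet g).
Proof.
move=> b0 gW; rewrite (big_rem g gW) /= mulrA -[X in eqm _ _ X]mul1r.
by apply: eqmM => //; apply: gtr_subst.
Qed.

(** Generating function of [gamma_trace]: the sum over subsets I is the expansion of the product
    over i. *)
Lemma gamma_series (y : K) :
  \sum_(g <- W) (\det (1%:M - y *: invmx (rho (gamma *m g))))%:P * twisted_hatdet g =
  (\prod_i (1 - (y * eps i) *: 'X^(w i))) * \sum_(g <- W) twisted_hatdet g.
Proof.
apply: eqm_all => -[|b] //; set n := b.+1.
set D := \prod_(h <- W) \det (1%:M - 'X *: map_mx polyC (invmx (gamma *m h))).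
have hD (c : 'M[K]_r -> {poly K}) : eqm n (\sum_(g <- W) c g * twisted_hatdet g)
    ((\sum_(g <- W) c g * gtr_poly n (pact (gamma *m g))) * D).
  rewrite mulr_suml !big_seq; apply: eqm_sum => g gW; rewrite -mulrA.
  by apply: eqmM => //; apply/eqm_sym/gtr_twisted_hatdet.
apply: eqm_trans (hD _) _.
have h1 : eqm n (\sum_(g <- W) twisted_hatdet g)
    ((\sum_(g <- W) gtr_poly n (pact (gamma *m g))) * D).
  by have := hD (fun=> 1); congr (eqm n _ (_ * D)); apply: eq_bigr => g _; apply: mul1r.
apply: eqm_trans _ (eqmM (@eqm_refl _ n _) (eqm_sym h1)).
rewrite mulrA; apply: eqmM => // d dn.
rewrite coef_sum; under [LHS]eq_bigr do rewrite coefCM coef_poly dn.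
rewrite gamma_trace; have -> : \prod_i (1 - (y * eps i) *: 'X^(w i)) =
    \sum_(I : {set 'I_m}) ((- y) ^+ #|I| * \prod_(i in I) eps i) *: 'X^(\sum_(i in I) w i)%N.
  under eq_bigr do rewrite addrC -scaleNr.
  rewrite bigA_distr; apply: eq_bigr => I _; rewrite (bigID (fun i => i \in I)) /=.
  rewrite [X in _ * X]big1 ?mulr1 => [|i /negPf -> //].
  rewrite (eq_bigr (fun i => (- y * eps i) *: 'X^(w i))) => [|i ->]; last by rewrite mulNr.
  by rewrite scaler_prod big_split /= prodr_const prodrXr.
rewrite mulr_suml coef_sum; apply: eq_bigr => I _.
rewrite -scalerAl coefZ coefXnM ltnNge; congr (_ * _); case: leqP => //= le.
rewrite coef_sum; apply: eq_bigr => g _; rewrite coef_poly (leq_ltn_trans _ dn) //.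
exact: leq_subr.
Qed.

End MainIdentity.

(** * Constant-coefficient operators and the apolar pairing *)

Section Apolarity.
Variables (K : fieldType) (charK : [pchar K] =i pred0) (r : nat).
Local Notation S := {mpoly K[r]}.
Implicit Types (A B : 'M[K]_r) (p q f : S) (n : 'X_{1..r}).

Lemma diffop_sum_subset s q f : uniq s -> {subset msupp q <= s} ->
  diffop q f = \sum_(n <- s) q@_n *: f^`M[n].
Proof.
move=> us qs; rewrite [RHS](bigID (fun n => n \in msupp q)) /=.
rewrite [X in _ + X]big1 ?addr0 => [|n /memN_msupp_eq0 ->]; last by rewrite scale0r.
rewrite -[RHS]big_filter; apply: perm_big; apply: uniq_perm.
- exact: msupp_uniq.
- exact: filter_uniq.
- by move=> n; rewrite mem_filter; case: (boolP (n \in msupp q)) => // /qs ->.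
Qed.

Lemma diffopDl p q f : diffop (p + q) f = diffop p f + diffop q f.
Proof.
pose s := undup (msupp (p + q) ++ msupp p ++ msupp q).
have us : uniq s by apply: undup_uniq.
rewrite !(@diffop_sum_subset s) // => [|n|n|n]; try by rewrite mem_undup !mem_cat => ->; rewrite ?orbT.
by rewrite -big_split; apply: eq_bigr => n _; rewrite mcoeffD scalerDl.
Qed.

Lemma diffopZl c q f : diffop (c *: q) f = c *: diffop q f.
Proof.
rewrite (@diffop_sum_subset (msupp q)) ?msupp_uniq //; last exact: msuppZ_le.
by rewrite scaler_sumr; apply: eq_bigr => n _; rewrite mcoeffZ scalerA.
Qed.

Lemma diffop0l f : diffop 0 f = 0.
Proof. by have := diffopZl 0 0 f; rewrite !scale0r. Qed.

Lemma diffopDr q f f' : diffop q (f + f') = diffop q f + diffop q f'.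
Proof. by rewrite /diffop -big_split; apply: eq_bigr => n _; rewrite linearD scalerDr. Qed.

Lemma diffopZr c q f : diffop q (c *: f) = c *: diffop q f.
Proof.
rewrite /diffop scaler_sumr; apply: eq_bigr => n _.
by rewrite linearZ /= !scalerA mulrC.
Qed.

Lemma diffop0r q : diffop q 0 = 0.
Proof. by have := diffopZr 0 q 0; rewrite !scale0r. Qed.

Lemma diffop_X n f : diffop 'X_[n] f = f^`M[n].
Proof. by rewrite /diffop msuppX big_seq1 mcoeffX eqxx scale1r. Qed.

Lemma diffop_C c f : diffop c%:MP f = c *: f.
Proof. by rewrite -[c%:MP]mulr1 -mpolyX0 mul_mpolyC diffopZl diffop_X mderivm0m. Qed.

Lemma diffopM p q f : diffop (p * q) f = diffop p (diffop q f).
Proof.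
elim/mpoly_ind_lin: p => [n|c p IH|p p' IH IH']; last 2 first.
- by rewrite -scalerAl !diffopZl IH.
- by rewrite mulrDl !diffopDl IH IH'.
elim/mpoly_ind_lin: q => [n'|c q IH|q q' IH IH'].
- by rewrite -mpolyXD !diffop_X addmC mderivmDm.
- by rewrite -scalerAr !diffopZl IH diffopZr.
- by rewrite mulrDr !diffopDl IH IH' diffopDr.
Qed.

Lemma subm_diag n : (n - n)%MM = 0%MM.
Proof. by rewrite -{1}[n]add0m addmK. Qed.

Lemma mderiv_subst B f i : (subst B f)^`M(i) = \sum_j B j i *: subst B f^`M(j).
Proof.
elim/mpoly_ind_alg: f => [c|k|p q IHp IHq|p q IHp IHq].
- by rewrite substC mderivC big1 // => j _; rewrite mderivC raddf0 scaler0.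
- rewrite substX linear_sum /= (bigD1 i) //= [RHS](bigD1 k) //=.
  rewrite !big1 => [|j jk|j ji]; rewrite ?addr0.
  + rewrite linearZ /= !mderivX !mnm1E !eqxx !scale1r.
    by rewrite !subm_diag mpolyX0 rmorph1.
  + by rewrite mderivX mnm1E eq_sym (negPf jk) scale0r raddf0 scaler0.
  + by rewrite linearZ /= mderivX mnm1E (negPf ji) scale0r scaler0.
- rewrite raddfD /= linearD /= IHp IHq -big_split; apply: eq_bigr => j _ /=.
  by rewrite linearD /= subst_add scalerDr.
- rewrite rmorphM /= mderivM IHp IHq mulr_suml mulr_sumr -big_split.
  apply: eq_bigr => j _ /=; rewrite mderivM subst_add !subst_mul.
  by rewrite scalerDr scalerAl scalerAr.
Qed.

(** The chain rule on first-order operators, extended to all symbols because sums and products of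
    symbols act by sums and composites. *)
Lemma diffop_subst B q f : diffop q (subst B f) = subst B (diffop (subst B^T q) f).
Proof.
elim/mpoly_ind_alg: q f => [c|i|p q IHp IHq|p q IHp IHq] f.
- by rewrite substC !diffop_C linearZ.
- rewrite substX diffop_X mderivmU1m mderiv_subst.
  have -> : diffop (\sum_j B^T i j *: 'X_j) f = \sum_j B j i *: f^`M(j).
    rewrite (big_morph (fun q => diffop q f) (id1 := 0) (op1 := +%R)).
    + by apply: eq_bigr => j _; rewrite diffopZl diffop_X mderivmU1m mxE.
    + by move=> p q; apply: diffopDl.
    + exact: diffop0l.
  by rewrite linear_sum; apply: eq_bigr => j _; rewrite linearZ.
- by rewrite subst_add !diffopDl IHp IHq subst_add.
- by rewrite subst_mul !diffopM IHq IHp.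
Qed.

Lemma diffop_pact A q f : diffop q (pact A f) = pact A (diffop (pact A^T q) f).
Proof. by rewrite /pact -!/(subst _ _) diffop_subst trmx_inv. Qed.

Definition mfact n : nat := (\prod_i (n i)`!)%N.

Lemma mfact_neq0 n : (mfact n)%:R != 0 :> K.
Proof.
rewrite ((pcharf0P K).1 charK) -lt0n prodn_gt0 // => i; exact: fact_gt0.
Qed.

(** Monomials are orthogonal, with <X^n, X^n> the product of the factorials of the exponents. This
    is nonzero in characteristic 0, so the pairing is nondegenerate. *)
Definition apolar q f : K := (diffop q f)@_0%MM.

Lemma apolarX n f : apolar 'X_[n] f = f@_n * (mfact n)%:R.
Proof.
rewrite /apolar diffop_X mcoeff_mderivm addm0 mulr_natr; congr (_ *+ _).
by apply: eq_bigr => i _; rewrite ffactnn.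
Qed.

Lemma apolarDl p q f : apolar (p + q) f = apolar p f + apolar q f.
Proof. by rewrite /apolar diffopDl mcoeffD. Qed.
Lemma apolarZl c q f : apolar (c *: q) f = c * apolar q f.
Proof. by rewrite /apolar diffopZl mcoeffZ. Qed.
Lemma apolarDr q f f' : apolar q (f + f') = apolar q f + apolar q f'.
Proof. by rewrite /apolar diffopDr mcoeffD. Qed.
Lemma apolarZr c q f : apolar q (c *: f) = c * apolar q f.
Proof. by rewrite /apolar diffopZr mcoeffZ. Qed.
Lemma apolar0l f : apolar 0 f = 0.
Proof. by rewrite /apolar diffop0l mcoeff0. Qed.
Lemma apolar0r q : apolar q 0 = 0.
Proof. by have := apolarZr 0 q 0; rewrite scale0r mul0r. Qed.
Lemma apolar_suml I (s : seq I) (P : pred I) (F : I -> S) f :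
  apolar (\sum_(i <- s | P i) F i) f = \sum_(i <- s | P i) apolar (F i) f.
Proof. by apply: (big_morph (fun q => apolar q f) (fun p q => apolarDl p q f) (apolar0l f)). Qed.
Lemma apolar_sumr I (s : seq I) (P : pred I) (F : I -> S) q :
  apolar q (\sum_(i <- s | P i) F i) = \sum_(i <- s | P i) apolar q (F i).
Proof. by apply: (big_morph (apolar q) (apolarDr q) (apolar0r q)). Qed.

Lemma apolar_eq0 f : (forall n, apolar 'X_[n] f = 0) -> f = 0.
Proof.
move=> f0; apply/mpolyP => n; rewrite mcoeff0; apply/eqP.
by have /eqP := f0 n; rewrite apolarX mulf_eq0 (negPf (mfact_neq0 n)) orbF.
Qed.

Lemma apolarM p q f : apolar (p * q) f = apolar p (diffop q f).
Proof. by rewrite /apolar diffopM. Qed.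

Lemma apolar_pact A q f : apolar q (pact A f) = apolar (pact A^T q) f.
Proof.
rewrite /apolar diffop_pact; move: (diffop _ _) => {q}f.
rewrite pactE; elim/mpoly_ind_alg: f => [c|i|p q IHp IHq|p q IHp IHq].
- by rewrite substC.
- rewrite (homog_mcoeff0 (d := 1)) ?(homog_mcoeff0 (d := 1)) //.
    by rewrite dhomogX /= mdeg1.
  by apply: subst_homog; rewrite dhomogX /= mdeg1.
- by rewrite raddfD /= !mcoeffD IHp IHq.
- by rewrite rmorphM /= !rmorphM /= IHp IHq.
Qed.

Lemma apolar_pihomog d e q f : f \is d.-homog ->
  apolar (pihomog mdeg e q) f = if e == d then apolar q f else 0.
Proof.
move=> fh; elim/mpoly_ind_lin: q => [n|c q IH|q q' IH IH'].
- rewrite pihomogX /=; have f0 : mdeg n != d -> apolar 'X_[n] f = 0.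
    by move=> nd; rewrite apolarX (dhomog_nemf_coeff fh nd) mul0r.
  case: (eqVneq (mdeg n) e) => [<-|ne]; first by case: (eqVneq (mdeg n) d) => // /f0.
  rewrite apolar0l; case: eqP => // ed; rewrite f0 //; by rewrite -ed.
- by rewrite linearZ /= !apolarZl IH; case: eqP => _; rewrite ?mulr0.
- by rewrite linearD /= !apolarDl IH IH'; case: eqP => _; rewrite ?addr0.
Qed.

Lemma apolar_rX q n : apolar q 'X_[n] = q@_n * (mfact n)%:R.
Proof.
elim/mpoly_ind_lin: q => [n'|c q IH|q q' IH IH'].
- by rewrite apolarX !mcoeffX; case: (eqVneq n n') => [->//|nn']; rewrite !mul0r.
- by rewrite apolarZl mcoeffZ IH mulrA.
- by rewrite apolarDl mcoeffD IH IH' mulrDl.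
Qed.

Lemma diffop_faithful q q' : (forall f, diffop q f = diffop q' f) -> q = q'.
Proof.
move=> e; apply/mpolyP => n; apply: (mulIf (mfact_neq0 n)).
by rewrite -!apolar_rX /apolar e.
Qed.

End Apolarity.

(** * Separating a vector, then a polynomial, from a subspace *)

Section LinearSeparation.
Variables (K : fieldType) (N : nat) (P : 'rV[K]_N -> Prop).
Hypothesis P0 : P 0.
Hypothesis PD : forall u v, P u -> P v -> P (u + v).
Hypothesis PZ : forall c u, P u -> P (c *: u).

(** The predicate [P] is first realised as the row space of a matrix of largest rank contained in
    it; the columns of its cokernel are linear forms vanishing on [P], and one of them is nonzero at
    v. *)
Lemma linear_separation v : ~ P v ->
  exists2 c : 'cV[K]_N, forall u, P u -> u *m c = 0 & v *m c != 0.
Proof.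
move=> nPv; pose Q k := exists2 A : 'M[K]_N, forall u : 'rV_N, (u <= A)%MS -> P u & \rank A = k.
have [k [A AP Ak] nQ] : exists2 k, Q k & ~ Q k.+1.
  apply: NNPP => nex; have QS k : Q k -> Q k.+1.
    by move=> Qk; apply: NNPP => nQk; apply: nex; exists k.
  have QN k : Q k.
    by elim: k => [|k /QS //]; exists 0; rewrite ?mxrank0 // => u /submx0null ->.
  by have [A _ rA] := QN N.+1; have := rank_leq_row A; rewrite rA ltnn.
have PA u : P u -> (u <= A)%MS.
  move=> Pu; apply: contraT => nuA; case: nQ; exists (A + u)%MS.
    move=> x /sub_addsmxP[[a b] /= ->]; apply: PD; first by apply: AP; apply: submxMl.
    by rewrite [b]mx11_scalar mul_scalar_mx; apply: PZ.
  have := mxrank_sum_cap A u; have -> : \rank u = 1%N.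
    by rewrite rank_rV; case: eqP nuA => // ->; rewrite sub0mx.
  have -> : \rank (A :&: u)%MS = 0%N.
    apply/eqP; rewrite -leqn0 -ltnS ltnNge; apply: contra nuA => r1.
    have : (u <= A :&: u)%MS.
      rewrite -(geq_leqif (mxrank_leqif_sup (capmxSr A u))).
      by apply: leq_trans r1; apply: rank_leq_row.
    by move/submx_trans; apply; apply: capmxSl.
  by rewrite addn0 Ak addn1.
have nvA : ~~ (v <= A)%MS by apply/negP => /AP.
move: nvA; rewrite submxE => /eqP nz.
have [j nzj] : exists j, (v *m cokermx A) 0 j != 0.
  apply: NNPP => nex; apply: nz; apply/rowP => j; rewrite [RHS]mxE; apply/eqP.
  by apply: contraT => nz; case: nex; exists j.
exists (col j (cokermx A)) => [u Pu|].
  have /PA := Pu; rewrite submxE => /eqP e.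
  by rewrite colE mulmxA e mul0mx.
apply: contraNneq nzj => e; have := congr1 (fun M : 'M_1 => M 0 0) e.
by rewrite /= colE mulmxA -colE [LHS]mxE => ->; rewrite mxE.
Qed.

End LinearSeparation.

Section ApolarSeparation.
Variables (K : fieldType) (charK : [pchar K] =i pred0) (r : nat).
Variables (W : seq 'M[K]_r) (HW : finite_reflection_group W).
Local Notation S := {mpoly K[r]}.

Lemma ideal_separation d (p : S) : p \is d.-homog -> ~ in_ideal W p ->
  exists2 f : S, f \is d.-homog &
    (forall u, in_ideal W u -> apolar u f = 0) /\ apolar p f != 0.
Proof.
move=> ph nIp; pose T := 'X_{1..r < d.+1}; pose N := #|{: T}|.
pose co (u : S) : 'rV[K]_N := \row_i u@_(enum_val i : T).
have coD u v : co (u + v) = co u + co v by apply/rowP => i; rewrite !mxE mcoeffD.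
have coZ c u : co (c *: u) = c *: co u by apply/rowP => i; rewrite !mxE mcoeffZ.
have coI u v : u \is d.-homog -> v \is d.-homog -> co u = co v -> u = v.
  move=> uh vh e; apply/mpolyP => n; case: (eqVneq (mdeg n) d) => nd; last first.
    by rewrite (dhomog_nemf_coeff uh nd) (dhomog_nemf_coeff vh nd).
  have nd1 : (mdeg n < d.+1)%N by rewrite nd.
  have := congr1 (fun M : 'rV_N => M 0 (enum_rank (BMultinom nd1 : T))) e.
  by rewrite /= !mxE enum_rankK.
pose P (x : 'rV[K]_N) := exists2 u, in_ideal W u & u \is d.-homog /\ x = co u.
have P0 : P 0.
  exists 0; first exact: in_ideal0.
  by split; [apply: rpred0|apply/rowP => i; rewrite !mxE mcoeff0].
have PD x y : P x -> P y -> P (x + y).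
  move=> [u Iu [uh ->]] [v Iv [vh ->]]; exists (u + v); first exact: in_idealD.
  by rewrite coD rpredD.
have PZ c x : P x -> P (c *: x).
  move=> [u Iu [uh ->]]; exists (c *: u); first exact: in_idealZ.
  by rewrite coZ rpredZ.
have nP : ~ P (co p) by move=> [u Iu [uh /(coI _ _ ph uh) e]]; apply: nIp; rewrite e.
have [c cP pc] := linear_separation P0 PD PZ nP.
(* The polynomial representing the linear form [c] on S_d; dividing by [mfact n] compensates the
   norms of the monomials. *)
pose f : S := \sum_(n : T | mdeg n == d) (c (enum_rank n) 0 / (mfact n)%:R) *: 'X_[n].
have fh : f \is d.-homog by apply: rpred_sum => n /eqP nd; apply: rpredZ; rewrite dhomogX /= nd.
have apf u : u \is d.-homog -> apolar u f = (co u *m c) 0 0.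
  move=> uh; rewrite mxE (reindex enum_rank) /=; last first.
    by exists enum_val => i _; rewrite (enum_rankK, enum_valK).
  rewrite /f apolar_sumr big_mkcond /=; apply: eq_bigr => n _.
  rewrite mxE enum_rankK apolarZr apolar_rX //; case: eqP => [_|/eqP nd]; last first.
    by rewrite (dhomog_nemf_coeff uh nd) mul0r.
  by rewrite mulrCA divfK ?mfact_neq0.
exists f => //; split=> [u Iu|].
  have := apolar_pihomog d u fh; rewrite eqxx => <-.
  rewrite apf ?pihomogP // cP ?mxE //.
  by exists (pihomog mdeg d u); [apply: in_ideal_pihomog|split=> //; apply: pihomogP].
rewrite apf //; apply: contraNneq pc => e; apply/eqP/matrixP => i j.
by rewrite !ord1 e mxE.
Qed.

End ApolarSeparation.

(** * From harmonic equivariants of G to a basis over the invariants of the transposed group *)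

Section Duality.
Variables (K : fieldType) (charK : [pchar K] =i pred0) (r : nat).
Variables (G : seq 'M[K]_r) (HG : finite_reflection_group G).
Local Notation S := {mpoly K[r]}.
Local Notation W := (map trmx G).

Lemma mem_trmx g : (g \in W) = (g^T \in G).
Proof.
apply/mapP/idP => [[h hG ->]|gG]; first by rewrite trmxK.
by exists g^T; rewrite ?trmxK.
Qed.

Lemma trmx_refl_group : finite_reflection_group W.
Proof.
case: (HG) => uG oneG invG mulG genG; split.
- by rewrite map_inj_uniq //; apply: trmx_inj.
- by rewrite mem_trmx trmx1.
- move=> g; rewrite !mem_trmx => /invG/andP[u v].
  by rewrite -unitmx_tr u trmx_inv v.
- by move=> g h; rewrite !mem_trmx trmx_mul => gG hG; apply: mulG.
- move=> g; rewrite mem_trmx => /genG[s [sG gE]]; exists (rev (map trmx s)); split.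
    rewrite all_rev all_map; apply: sub_all sG => t /= /andP[tG tr].
    rewrite mem_trmx trmxK tG /=; move: tr; rewrite /pseudo_reflection -mxrank_tr.
    by rewrite raddfB /= trmx1.
  rewrite -[g]trmxK gE; elim: s {gE sG} => [|t s IH] /=; first by rewrite trmx1.
  rewrite trmx_mul IH rev_cons -cats1 foldr_cat /= mulmx1.
  have fold_mul (l : seq 'M[K]_r) A B : foldr mulmx (A *m B) l = foldr mulmx A l *m B.
    by elim: l => //= x l ->; rewrite mulmxA.
  by rewrite -{2}[t^T]mul1mx fold_mul.
Qed.

Lemma invariant_op_winv q : invariant_op G q <-> winv W q.
Proof.
have HW := trmx_refl_group; split=> [iq g gW|iq g gG f].
  have gG : g^T \in G by rewrite -mem_trmx.
  apply: (diffop_faithful charK) => f; have gU := refl_unit HG gG.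
  apply: (can_inj (pactK gU)); rewrite -(iq _ gG) diffop_pact trmxK //.
by rewrite diffop_pact iq // mem_trmx trmxK.
Qed.

Section DualModule.
Variable m : nat.
Variables (sigma rho : 'M[K]_r -> 'M[K]_m).
Hypothesis sigma1 : sigma 1%:M = 1%:M.
Hypothesis sigmaM : forall g h, g \in G -> h \in G -> sigma (g *m h) = sigma g *m sigma h.
Hypothesis rhoE : forall A, rho A = (sigma A^T)^T.

Lemma dual_rho1 : rho 1%:M = 1%:M.
Proof. by rewrite rhoE trmx1 sigma1 trmx1. Qed.

(** Each of the two transpositions in [rhoE] reverses products. [rho] is kept abstract, specified by
    an equation, so that the identity and a determinant character can be substituted for it. *)
Lemma dual_rhoM g h : g \in W -> h \in W -> rho (g *m h) = rho g *m rho h.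
Proof. by rewrite !mem_trmx !rhoE trmx_mul => gG hG; rewrite sigmaM // trmx_mul. Qed.

Definition vpair (u F : 'rV[S]_m) : K := \sum_l apolar (u 0 l) (F 0 l).

Lemma vpairDl u v F : vpair (u + v) F = vpair u F + vpair v F.
Proof. by rewrite -big_split; apply: eq_bigr => l _; rewrite mxE apolarDl. Qed.
Lemma vpairDr u F F' : vpair u (F + F') = vpair u F + vpair u F'.
Proof. by rewrite -big_split; apply: eq_bigr => l _; rewrite mxE apolarDr. Qed.
Lemma vpairZl c u F : vpair (c%:MP *: u) F = c * vpair u F.
Proof. by rewrite /vpair mulr_sumr; apply: eq_bigr => l _; rewrite mxE mul_mpolyC apolarZl. Qed.
Lemma vpairZr c u F : vpair u (c%:MP *: F) = c * vpair u F.
Proof. by rewrite /vpair mulr_sumr; apply: eq_bigr => l _; rewrite mxE mul_mpolyC apolarZr. Qed.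
Lemma vpair0l F : vpair 0 F = 0.
Proof. by rewrite /vpair big1 // => l _; rewrite mxE apolar0l. Qed.
Lemma vpair0r u : vpair u 0 = 0.
Proof. by rewrite /vpair big1 // => l _; rewrite mxE apolar0r. Qed.
Lemma vpair_suml I (s : seq I) (P : pred I) (u : I -> 'rV[S]_m) F :
  vpair (\sum_(i <- s | P i) u i) F = \sum_(i <- s | P i) vpair (u i) F.
Proof. by apply: (big_morph (fun u => vpair u F) (fun u v => vpairDl u v F) (vpair0l F)). Qed.
Lemma vpair_sumr I (s : seq I) (P : pred I) (F : I -> 'rV[S]_m) u :
  vpair u (\sum_(i <- s | P i) F i) = \sum_(i <- s | P i) vpair u (F i).
Proof. by apply: (big_morph (vpair u) (vpairDr u) (vpair0r u)). Qed.

Lemma vpair_tact A u F : vpair (tact rho A^T u) F = vpair u (tact sigma A F).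
Proof.
rewrite /vpair; under eq_bigr do rewrite tactE apolar_suml.
under [RHS]eq_bigr do rewrite tactE apolar_sumr.
rewrite exchange_big; apply: eq_bigr => i _; apply: eq_bigr => j _ /=.
by rewrite apolarZl apolarZr apolar_pact rhoE trmxK -trmx_inv mxE.
Qed.

Lemma vpair_vavg u F : (forall g, g \in G -> tact sigma g F = F) ->
  vpair (vavg W rho u) F = vpair u F.
Proof.
move=> iF; rewrite vpairZl vpair_suml big_map big_seq.
rewrite (eq_bigr (fun=> vpair u F)) => [|g gG]; last by rewrite vpair_tact iF.
rewrite -big_seq big_const_seq count_predT iter_addr_0 size_map -(mulr_natl (vpair u F)) mulrA.
by rewrite mulVf ?mul1r // (refl_size_neq0 charK HG).
Qed.

Lemma vavg_vpair u F : vinv W rho u -> vpair u (vavg G sigma F) = vpair u F.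
Proof.
move=> iu; rewrite vpairZr vpair_sumr big_seq.
rewrite (eq_bigr (fun=> vpair u F)) => [|g gG]; last first.
  by rewrite -vpair_tact iu // mem_trmx trmxK.
rewrite -big_seq big_const_seq count_predT iter_addr_0 -(mulr_natl (vpair u F)) mulrA.
by rewrite mulVf ?mul1r // (refl_size_neq0 charK HG).
Qed.

Lemma vpair_vpih d e u F : vhom d F -> vpair (vpih e u) F = if e == d then vpair u F else 0.
Proof.
move=> Fh; have e1 l : apolar (vpih e u 0 l) (F 0 l) =
    if e == d then apolar (u 0 l) (F 0 l) else 0.
  by rewrite mxE (apolar_pihomog _ _ (Fh l)).
by rewrite /vpair; under eq_bigr do rewrite e1; case: eqP => // _; rewrite big1.
Qed.

Lemma harmonic_ideal_orthogonal p f : in_ideal W p -> harmonic G f -> apolar p f = 0.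
Proof.
move=> Ip fH; elim: Ip => [|p1 p2 _ IH1 _ IH2|a q ia a0]; first exact: apolar0l.
  by rewrite apolarDl IH1 IH2 addr0.
by rewrite mulrC apolarM fH ?apolar0r //; apply/invariant_op_winv.
Qed.

Lemma vpair_ideal (u F : 'rV[S]_m) : (forall l, in_ideal W (u 0 l)) -> (forall l, harmonic G (F 0 l)) ->
  vpair u F = 0.
Proof. by move=> Iu HF; rewrite /vpair big1 // => l _; apply: harmonic_ideal_orthogonal. Qed.

(** To see that q(d) f = 0, pair it with every monomial: <X^n, q(d) f> = <X^n q, f>, and X^n q lies
    in the ideal. *)
Lemma orthogonal_harmonic f : (forall u, in_ideal W u -> apolar u f = 0) -> harmonic G f.
Proof.
move=> fo q /invariant_op_winv iq q0; apply: (apolar_eq0 charK) => n.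
by rewrite -apolarM; apply: fo; rewrite mulrC; apply: in_ideal_gen.
Qed.

Lemma harmonic_pact g f : g \in G -> harmonic G f -> harmonic G (pact g f).
Proof. by move=> gG fH q iq q0; rewrite iq // fH // pact_zero. Qed.

Lemma harmonic_lin c f f' : harmonic G f -> harmonic G f' -> harmonic G (c *: f + f').
Proof. by move=> fH fH' q iq q0; rewrite diffopDr diffopZr fH ?fH' // scaler0 addr0. Qed.

Variables (k : nat) (B : 'I_k -> 'rV[S]_m) (deg : 'I_k -> nat).
Hypothesis HB : homog_basis G sigma B deg.

(** Independence of [B] makes its finite coefficient matrix right-invertible; the inverse, divided
    by the norms of the monomials, gives dual vectors, not yet equivariant or homogeneous. *)
Lemma dual_vectors : exists z : 'I_k -> 'rV[S]_m, forall i j, vpair (z i) (B j) = (i == j)%:R.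
Proof.
case: HB => _ Bh Bfree _; pose b := (\max_i deg i).+1.
pose T := ('I_m * 'X_{1..r < b})%type; pose N := #|{: T}|.
pose A : 'M[K]_(k, N) := \matrix_(j, i) (B j 0 (enum_val i : T).1)@_(enum_val i : T).2.
have degb j l n : (b <= mdeg n)%N -> (B j 0 l)@_n = 0.
  move=> bn; apply: (dhomog_nemf_coeff (Bh j l)); rewrite /= gtn_eqF //.
  by apply: leq_trans bn; rewrite ltnS; apply: (leq_bigmax (F := deg)).
have : row_free A.
  rewrite -kermx_eq0; apply/eqP/row_matrixP => i; rewrite row0.
  have := row_sub i (kermx A); set v := row _ _ => /sub_kermxP vA.
  apply/rowP => j; rewrite [RHS]mxE; apply: (Bfree (fun j => v 0 j)).
  apply/rowP => l; apply/mpolyP => n; rewrite summxE linear_sum !mxE mcoeff0 /=.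
  have [bn|nb] := leqP b (mdeg n).
    by rewrite big1 // => j' _; rewrite mxE mcoeffCM degb ?mulr0.
  have := congr1 (fun M : 'rV_N => M 0 (enum_rank ((l, BMultinom nb) : T))) vA.
  rewrite /= mxE [RHS]mxE => e; rewrite -[RHS]e; apply: eq_bigr => j' _.
  by rewrite mxE mcoeffCM [A _ _]mxE enum_rankK.
case/row_freeP => A' AA'.
exists (fun i => \sum_(t : T) (A' (enum_rank t) i / (mfact t.2)%:R)%:MP *:
   ('X_[t.2] *: delta_mx 0 t.1)) => i j.
rewrite vpair_suml; transitivity ((A *m A') j i); last by rewrite AA' mxE eq_sym.
rewrite mxE (reindex enum_rank) /=; last first.
  by exists enum_val => t _; rewrite (enum_rankK, enum_valK).
apply: eq_bigr => -[l n] _ /=; rewrite vpairZl mxE enum_rankK /=.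
rewrite /vpair (bigD1 l) //= big1 ?addr0 => [|l' ll']; last first.
  by rewrite !mxE (negPf ll') andbF mulr0 apolar0l.
rewrite !mxE !eqxx mulr1 apolarX //.
by rewrite mulrCA divfK ?mfact_neq0.
Qed.

(** Averaging and taking homogeneous parts preserve the pairings with [B]. Pairing with harmonics
    kills the ideal, so the dual vectors are independent modulo it; spanning is proved by
    separation. *)
Lemma dual_basis : exists z : 'I_k -> 'rV[S]_m,
  winv_basis W rho z deg /\ forall i j, vpair (z i) (B j) = (i == j)%:R.
Proof.
have HW := trmx_refl_group.
case: (HB) => BH Bh Bfree Bspan; have [z0 z0E] := dual_vectors.
pose z i := vpih (deg i) (vavg W rho (z0 i)).
have zE i j : vpair (z i) (B j) = (i == j)%:R.
  rewrite (vpair_vpih _ _ (Bh j)) (vpair_vavg _ (proj2 (BH j))) z0E.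
  by case: eqP => // ne; case: eqP => // e; rewrite e in ne.
have iz i : vinv W rho (z i) by apply/vinv_vpih/(vavg_vinv HW dual_rho1 dual_rhoM).
have zh i : vhom (deg i) (z i) by apply: vpih_hom.
have sumE (c : 'I_k -> K) j : vpair (\sum_i (c i)%:MP *: z i) (B j) = c j.
  rewrite vpair_suml (bigD1 j) //= big1 ?addr0 => [|i ij]; last first.
    by rewrite vpairZl zE (negPf ij) mulr0.
  by rewrite vpairZl zE eqxx mulr1.
have indz : indep_mod_ideal W z.
  move=> c cI j; rewrite -(sumE c j); apply: vpair_ideal => // l.
  by case: (BH j).
exists z; split=> //; split=> //; last exact: (indep_mod_ideal_free charK HW zh indz).
apply: (span_of_mod_ideal charK HW dual_rho1 dual_rhoM iz zh) => d F iF Fh.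
(* With these coefficients F - E is orthogonal to every [B j], hence to all harmonic
   equivariants. *)
exists (fun i => vpair F (B i)); set E := \sum_i _.
have vF' j : vpair (F - E) (B j) = 0.
  by rewrite vpairDl -scaleN1r -mpolyC1 -mpolyCN vpairZl sumE mulN1r subrr.
have iF' : vinv W rho (F - E).
  apply: vinvB => //; apply: vinv_sum => i _; apply: vinvZ => //; exact: winvC.
have Eh : vhom d E.
  move=> l; rewrite summxE; apply: rpred_sum => i _; rewrite mxE mul_mpolyC.
  have [<-|ne] := eqVneq (deg i) d; first by apply: rpredZ; apply: zh.
  have -> : vpair F (B i) = 0; last by rewrite scale0r; apply: rpred0.
  by rewrite -(vpih_id Fh) (vpair_vpih _ _ (Bh i)) eq_sym (negPf ne).
move=> l; apply: NNPP => nI.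
have F'h : (F - E) 0 l \is d.-homog by rewrite !mxE; apply: rpredB; [apply: Fh|apply: Eh].
(* If coordinate l were outside the ideal, a harmonic f would detect it; the average of f e_l is a
   harmonic equivariant with the same pairing against the equivariant F - E, a contradiction. *)
have [f fh [fo fF]] := ideal_separation charK F'h nI.
have fH := orthogonal_harmonic fo.
pose D := vavg G sigma (f *: delta_mx 0 l).
have DH : in_HMG G sigma D.
  split; last exact: (vavg_vinv HG sigma1 sigmaM).
  move=> j; rewrite mxE mul_mpolyC summxE.
  have H0 : harmonic G 0 by move=> q _ _; apply: diffop0r.
  rewrite -[_ *: _]addr0; apply: harmonic_lin => //; rewrite big_seq.
  elim/big_rec: _ => // g p gG pH; rewrite -[tact _ _ _ _ _]scale1r; apply: harmonic_lin => //.
  rewrite tactE; elim/big_rec: _ => // i q _ qH; apply: harmonic_lin => //.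
  apply: harmonic_pact => //; rewrite !mxE eqxx /=.
  by case: (i == l); rewrite ?mulr0 ?mulr1.
have [c Dc] := Bspan D DH.
case/negP: fF; apply/eqP; have : vpair (F - E) D = 0.
  by rewrite Dc vpair_sumr big1 // => j _; rewrite vpairZr vF' mulr0.
rewrite vavg_vpair // => e; rewrite -[RHS]e /vpair (bigD1 l) //= big1 ?addr0.
  by rewrite !mxE !eqxx mulr1.
by move=> i il; rewrite !mxE (negPf il) andbF mulr0 apolar0r.
Qed.

End DualModule.
End Duality.

(** * Generators of the determinant semi-invariants *)

Section SemiInvariants.
Variables (K : closedFieldType) (charK : [pchar K] =i pred0) (r : nat).
Variables (W : seq 'M[K]_r) (HW : finite_reflection_group W).
Variables (m : nat) (rho : 'M[K]_r -> 'M[K]_m).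
Hypothesis rho1 : rho 1%:M = 1%:M.
Hypothesis rhoM : forall g h, g \in W -> h \in W -> rho (g *m h) = rho g *m rho h.
Local Notation S := {mpoly K[r]}.
Local Notation detrho := (fun g => (\det (rho g))%:M : 'M[K]_1).

Lemma detrho1 : detrho 1%:M = 1%:M. Proof. by rewrite /= rho1 det1. Qed.

Lemma detrhoM g h : g \in W -> h \in W -> detrho (g *m h) = detrho g *m detrho h.
Proof. by move=> gW hW; rewrite /= rhoM // det_mulmx scalar_mxM. Qed.

(** The semi-invariants form a free module of rank one, generated by t. Then det Phi = a t with a
    invariant, and equality of degrees reduces a to its constant term, nonzero because det Phi
    is. *)
Lemma semi_dvd_of_degree (z : 'I_m -> 'rV[S]_m) w k (t : 'I_k -> 'rV[S]_1) wt :
    winv_basis W rho z w -> winv_basis W detrho t wt ->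
    (\sum_i w i = \sum_i wt i)%N ->
  forall h : S, (forall g, g \in W -> pact g h = \det (rho g) *: h) ->
  exists q, h = q * \det (\matrix_i z i).
Proof.
move=> zb tb ww; have k1 := winv_basis_size charK HW detrho1 detrhoM tb; subst k.
move: ww; rewrite big_ord1 => ww; have [it th spt _] := tb.
have semi_t (h : S) : (forall g, g \in W -> pact g h = \det (rho g) *: h) ->
    exists2 b, winv W b & h = b * t 0 0 0.
  move=> hW; have iF : vinv W detrho (const_mx h).
    move=> g gW; apply/rowP => j; rewrite ord1 tactE big_ord1 /= invmx_scalar !mxE /= mulr1n.
    rewrite hW // scalerA mulVf ?scale1r // -unitfE -unitmxE.
    exact: (rho_unit HW rho1 rhoM gW).
  have [b ib e] := spt _ iF; exists (b 0); first exact: ib.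
  have := congr1 (fun M : 'rV_1 => M 0 0) e.
  by rewrite /= big_ord1 !mxE.
have [a ia aE] := semi_t _ (pact_det_Phi HW rho1 rhoM zb).
have Qh := det_Phi_homog zb.
have [c aE'] : exists c : K, \det (\matrix_i z i) = c *: t 0 0 0.
  exists (pihomog mdeg 0 a)@_0%MM; rewrite -mul_mpolyC -(homog0C (pihomogP _ _ _)).
  by rewrite -(pihomog_mulr _ _ (th 0 0)) add0n -aE -ww pihomog_dE.
have c0 : c != 0.
  have := det_Phi_neq0 charK HW zb; rewrite aE'; apply: contraNneq => ->.
  by rewrite scale0r.
move=> h /semi_t[b _ ->]; exists (c^-1 *: b).
by rewrite aE' -scalerAl -scalerAr scalerA mulVf // scale1r.
Qed.

End SemiInvariants.

(** * The series identity for a given eigenbasis of harmonics *)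

Section EigenSeries.
Variables (K : closedFieldType) (charK : [pchar K] =i pred0) (r : nat).
Variables (G : seq 'M[K]_r) (gamma : 'M[K]_r) (HG : finite_reflection_group G).
Hypothesis gammaU : gamma \in unitmx.
Hypothesis gamma_norm : forall g, g \in G ->
  (gamma *m g *m invmx gamma \in G) && (invmx gamma *m g *m gamma \in G).
Local Notation S := {mpoly K[r]}.
Local Notation W := (map trmx G).

Section Rep.
Variables (m : nat) (sigma : 'M[K]_r -> 'M[K]_m).
Hypothesis Hsigma : is_rep G gamma sigma.

Variable rho : 'M[K]_r -> 'M[K]_m.
Hypothesis rhoE : forall A, rho A = (sigma A^T)^T.

Lemma in_Ggamma_G g : g \in G -> in_Ggamma G gamma g.
Proof. by move=> gG; exists g => //; exists 0%N; left; rewrite expr0 mulmx1. Qed.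

Lemma in_Ggamma_gamma : in_Ggamma G gamma gamma.
Proof. by exists 1%:M; [case: HG|exists 1%N; left; rewrite mul1mx]. Qed.

Lemma in_Ggamma_gammaV : in_Ggamma G gamma (invmx gamma).
Proof. by exists 1%:M; [case: HG|exists 1%N; right; rewrite mul1mx]. Qed.

Lemma is_rep1 : sigma 1%:M = 1%:M. Proof. by case: Hsigma. Qed.

Lemma is_repM g h : g \in G -> h \in G -> sigma (g *m h) = sigma g *m sigma h.
Proof. by move=> gG hG; case: Hsigma => _; apply; apply: in_Ggamma_G. Qed.

Lemma is_rep_gammal g : g \in G -> sigma (gamma *m g) = sigma gamma *m sigma g.
Proof.
by move=> gG; case: Hsigma => _; apply; [apply: in_Ggamma_gamma|apply: in_Ggamma_G].
Qed.

Lemma is_rep_gammar g : g \in G -> sigma (g *m gamma) = sigma g *m sigma gamma.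
Proof.
by move=> gG; case: Hsigma => _; apply; [apply: in_Ggamma_G|apply: in_Ggamma_gamma].
Qed.

Lemma is_rep_gamma_unit : sigma gamma \in unitmx.
Proof.
case: Hsigma => s1 sM; have := sM _ _ in_Ggamma_gamma in_Ggamma_gammaV.
by rewrite mulmxV // s1 => /esym/mulmx1_unit[].
Qed.

Lemma dual_gammaU : gamma^T \in unitmx. Proof. by rewrite unitmx_tr. Qed.

Lemma dual_rho_gammaU : rho gamma^T \in unitmx.
Proof. by rewrite rhoE trmxK unitmx_tr is_rep_gamma_unit. Qed.

Lemma dual_gammal g : g \in W -> rho (gamma^T *m g) = rho gamma^T *m rho g.
Proof. by rewrite mem_trmx !rhoE trmx_mul trmxK => gG; rewrite is_rep_gammar // trmx_mul. Qed.

Lemma dual_gammar g : g \in W -> rho (g *m gamma^T) = rho g *m rho gamma^T.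
Proof. by rewrite mem_trmx !rhoE trmx_mul trmxK => gG; rewrite is_rep_gammal // trmx_mul. Qed.

Let HW := trmx_refl_group HG.
Let rho1 : rho 1%:M = 1%:M. Proof. exact: (dual_rho1 is_rep1 rhoE). Qed.
Let rhoM g h : g \in W -> h \in W -> rho (g *m h) = rho g *m rho h.
Proof. exact: (dual_rhoM is_repM rhoE). Qed.

Lemma vinv_gamma F : vinv W rho F -> vinv W rho (tact rho gamma^T F).
Proof.
move=> iF g gW; have gU := refl_unit HW gW; have rgU := rho_unit HW rho1 rhoM gW.
have gammaTU := dual_gammaU.
pose h := invmx gamma^T *m g *m gamma^T.
have hW : h \in W.
  move: gW; rewrite !mem_trmx /h !trmx_mul trmxK trmx_inv trmxK mulmxA => /gamma_norm.
  by case/andP.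
have ghE : g *m gamma^T = gamma^T *m h by rewrite /h !mulmxA mulmxV // mul1mx.
rewrite -(tactM _ gU gammaTU rgU dual_rho_gammaU (dual_gammar gW)) ghE.
have rhU := rho_unit HW rho1 rhoM hW.
by rewrite (tactM _ gammaTU (refl_unit HW hW) dual_rho_gammaU rhU (dual_gammal hW)) iF.
Qed.

Variables (B : 'I_m -> 'rV[S]_m) (degs : 'I_m -> nat) (eps : 'I_m -> K).
Hypothesis HB : homog_eigenbasis G gamma sigma B degs eps.

Lemma eigen_series k (t : 'I_k -> 'rV[S]_1) wt (y : K) :
    winv_basis W (fun g => (\det (rho g))%:M : 'M_1) t wt ->
    (\sum_i degs i = \sum_i wt i)%N ->
  \sum_(g <- W) (\det (1%:M - y *: invmx (rho (gamma^T *m g))))%:P * twisted_hatdet W gamma^T g =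
  (\prod_i (1 - (y * eps i) *: 'X^(degs i))) * \sum_(g <- W) twisted_hatdet W gamma^T g.
Proof.
move=> tb dw; case: HB => Hhb Beig.
have [z [zb zB]] := dual_basis charK HG is_rep1 is_repM rhoE Hhb.
have [iz zh spz _] := zb.
have Bh i l : harmonic G (B i 0 l) by case: Hhb => BH _ _ _; case: (BH i).
have [C0 C0E] : exists C0 : 'I_m -> 'I_m -> S, forall i, (forall j, winv W (C0 i j)) /\
    tact rho gamma^T (z i) = \sum_j C0 i j *: z j.
  apply: (functional_choice (fun i Ci => (forall j, winv W (Ci j)) /\
    tact rho gamma^T (z i) = \sum_j Ci j *: z j)) => i.
  by have [b ib e] := spz _ (vinv_gamma (iz i)); exists b.
(* The coordinates [C0] need not be homogeneous; since gamma preserves degrees, the components of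
   degree [degs i - degs j] satisfy the same relation. *)
pose C : 'M[S]_m := \matrix_(i, j)
  (if (degs j <= degs i)%N then pihomog mdeg (degs i - degs j) (C0 i j) else 0).
have Cinv i j : winv W (C i j).
  by rewrite mxE; case: ifP => _; [apply: winv_pihomog; case: (C0E i)|apply: winv0].
have CE i : tact rho gamma^T (z i) = \sum_j C i j *: z j.
  rewrite -[LHS](vpih_id (tact_vhom rho gamma^T (zh i))) (proj2 (C0E i)) vpih_sum.
  apply: eq_bigr => j _; apply/rowP => l; rewrite !mxE; case: leqP => le.
    by have := pihomog_mulr (degs i - degs j) (C0 i j) (zh j l); rewrite subnK.
  by rewrite mul0r (pihomog_mulr_lt _ (zh j l)).
(* Pairing with [B j] reads off constant terms: the rest of [C i l] is an invariant without constant
   term, so its multiples lie in the ideal, orthogonal to harmonics. Adjointness turns the pairing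
   into an eigenvalue of gamma on [B]. *)
have Cconst i j : (C i j)@_0%MM = eps i *+ (i == j).
  have : vpair (tact rho gamma^T (z i)) (B j) = eps i *+ (i == j).
    rewrite (vpair_tact rhoE) Beig vpairZr zB.
    by case: eqP => [->|_]; rewrite ?mulr1 ?mulr0.
  rewrite CE vpair_suml (bigD1 j) //=.
  have zC l : vpair (C i l *: z l) (B j) = (C i l)@_0%MM * (l == j)%:R.
    have -> : C i l *: z l = ((C i l)@_0%MM)%:MP *: z l + (C i l - ((C i l)@_0%MM)%:MP) *: z l.
      by rewrite -scalerDl addrC subrK.
    rewrite vpairDl vpairZl zB (vpair_ideal charK HG _ (Bh j)) ?addr0 // => l'.
    rewrite mxE; apply: in_ideal_gen; first by apply: winvD => //; apply/winvN/winvC.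
    by rewrite mcoeffB mcoeffC eqxx mulr1 subrr.
  rewrite zC eqxx mulr1 big1 ?addr0 // => l lj.
  by rewrite zC (negPf lj) mulr0.
have semi := semi_dvd_of_degree charK HW rho1 rhoM zb tb dw.
apply: (gamma_series charK HW rho1 rhoM zb semi dual_gammaU dual_rho_gammaU dual_gammal CE _ _ Cconst).
  by move=> i j le; rewrite mxE le pihomogP.
by move=> i j lt; rewrite mxE leqNgt lt.
Qed.

End Rep.

End EigenSeries.

(** * Passage to rational functions in x and y *)

Section RationalFunctions.
Variables (K : closedFieldType) (charK : [pchar K] =i pred0) (r : nat).

Definition det1y n (B : 'M[K]_n) : {poly {poly K}} :=
  \det (1%:M - 'X *: map_mx (fun c => c%:P%:P) B).

Lemma det1y_const n (B : 'M[K]_n) (c : K) :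
  (det1y B).[c%:P] = (\det (1%:M - c *: B))%:P.
Proof.
rewrite -[LHS]/(horner_eval c%:P _) -!det_map_mx; congr (\det _).
apply/matrixP => i j; rewrite !mxE /= /horner_eval !hornerE polyCB polyCM.
by rewrite !polyC_natr -[in LHS]polyC_natr hornerC.
Qed.

Lemma det1y_X n (B : 'M[K]_n) : (det1y B).['X] = det1x B.
Proof.
rewrite -[LHS]/(horner_eval 'X _) -det_map_mx; congr (\det _).
apply/matrixP => i j; rewrite !mxE /= /horner_eval !hornerE.
by rewrite -[in LHS]polyC_natr hornerC.
Qed.

Lemma det1m_y n (A : 'M[K]_n) : det1m yv A = tofrac (det1y (dualmx A)).
Proof.
rewrite /det1m -det_map_mx; congr (\det _); apply/matrixP => i j.
by rewrite !mxE /= tofracB tofracM rmorph_nat.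
Qed.

Lemma det1m_x n (A : 'M[K]_n) : det1m xv A = tofrac (det1x (dualmx A))%:P.
Proof.
rewrite /det1m -!det_map_mx; congr (\det _); apply/matrixP => i j.
by rewrite !mxE /= polyCB polyCM tofracB tofracM !rmorph_nat.
Qed.

Lemma det1x_neq0 n (B : 'M[K]_n) : det1x B != 0.
Proof.
apply/eqP => /(congr1 (horner^~ 0)); rewrite horner_det1x scale0r subr0 det1 horner0.
by move/eqP; rewrite oner_eq0.
Qed.

(** Both sides are polynomials in y over K[x]; the scalar identities make them agree at all positive
    integers. *)
Lemma bivariate_series m (s : seq 'M[K]_r) (R : 'M[K]_r -> 'M[K]_m) (h : 'M[K]_r -> {poly K})
    (eps : 'I_m -> K) (w : 'I_m -> nat) (H : {poly K}) :
    (forall y, \sum_(g <- s) (\det (1%:M - y *: R g))%:P * h g =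
       (\prod_i (1 - (y * eps i) *: 'X^(w i))) * H) ->
  \sum_(g <- s) det1y (R g) * (h g)%:P =
  (\prod_i (1 - 'X * (eps i *: 'X^(w i))%:P)) * H%:P.
Proof.
have charKX : [pchar {poly K}] =i pred0 by move=> p; rewrite pchar_poly charK.
move=> ser; apply: (poly_eq_char0 charKX) => n.
rewrite -polyC_natr horner_sum hornerM hornerC horner_prod.
transitivity (\prod_i (1 - (n.+1%:R * eps i) *: 'X^(w i)) * H).
  by rewrite -ser; apply: eq_bigr => g _; rewrite hornerM hornerC det1y_const.
by congr (_ * _); apply: eq_bigr => i _; rewrite !hornerE -scalerA mul_polyC.
Qed.

End RationalFunctions.

Theorem theorem3p1 (K : closedFieldType) (HK0 : [pchar K] =i pred0)
  (r : nat) (G : seq 'M[K]_r) (gamma : 'M[K]_r)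
  (HG : finite_reflection_group G)
  (Hgamma_unit : gamma \in unitmx) (Hgamma_ss : diagonalizable gamma)
  (Hgamma_norm : forall g, g \in G ->
     (gamma *m g *m invmx gamma \in G) && (invmx gamma *m g *m gamma \in G))
  (m : nat) (sigma : 'M[K]_r -> 'M[K]_m)
  (Hsigma : is_rep G gamma sigma) (Hsigma_ss : diagonalizable (sigma gamma))
  (HN : exists Nval, N_is G (top_ext sigma) Nval /\ N_is G sigma Nval)
  (k : nat) (B : 'I_k -> 'rV[{mpoly K[r]}]_m) (degs : 'I_k -> nat) (eps : 'I_k -> K)
  (HB : homog_eigenbasis G gamma sigma B degs eps)
  (kV : nat) (BV : 'I_kV -> 'rV[{mpoly K[r]}]_r) (mV : 'I_kV -> nat) (epsV : 'I_kV -> K)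
  (HBV : homog_eigenbasis G gamma (fun A : 'M[K]_r => A) BV mV epsV) :
  (size G)%:R^-1 *
    \sum_(g <- G) det1m yv (sigma (g *m gamma)) / det1m xv (g *m gamma)
  = (\prod_(i < k) (1 - yv * kc (eps i) * xv ^+ degs i))
    / (\prod_(i < kV) (1 - kc (epsV i) * xv ^+ (mV i).+1)).
Proof.
pose W := map trmx G; have HW : finite_reflection_group W := trmx_refl_group HG.
pose rho A := (sigma A^T)^T; pose rhoV (A : 'M[K]_r) := A.
have rhoE A : rho A = (sigma A^T)^T by [].
have rhoVE A : rhoV A = (A^T)^T by rewrite trmxK.
have HsigmaV : is_rep G gamma (fun A => A) by split.
have [s1 sM] := (is_rep1 Hsigma, is_repM Hsigma).
have [s1V sMV] := (is_rep1 HsigmaV, is_repM HsigmaV).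
have [rho1 rhoM] := (dual_rho1 s1 rhoE, dual_rhoM sM rhoE).
have rhoV1 := dual_rho1 (sigma := fun A => A) s1V rhoVE.
have rhoVM := dual_rhoM (sigma := fun A => A) sMV rhoVE.
have [z [zb _]] := dual_basis HK0 HG s1 sM rhoE (proj1 HB).
have [zV [zVb _]] := dual_basis (sigma := fun A => A) HK0 HG s1V sMV rhoVE (proj1 HBV).
have km := winv_basis_size HK0 HW rho1 rhoM zb.
have kVr := winv_basis_size HK0 HW rhoV1 rhoVM zVb.
subst k kV.
(* Dualizing the basis that witnesses N(Lambda^m M) gives the generator of the semi-invariants, and
   the hypothesis supplies its degree. *)
have [k [t [wt [tb dw]]]] : exists k (t : 'I_k -> 'rV[{mpoly K[r]}]_1) wt,
    winv_basis W (fun g => (\det (rho g))%:M : 'M_1) t wt /\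
    (\sum_i degs i = \sum_i wt i)%N.
  have [N [[k1 [B1 [d1 [hB1 ->]]]] [k2 [B2 [d2 [hB2 dd]]]]]] := HN.
  have top1 : top_ext sigma 1%:M = 1%:M by rewrite /top_ext s1 det1.
  have topM g h : g \in G -> h \in G ->
      top_ext sigma (g *m h) = top_ext sigma g *m top_ext sigma h.
    by move=> gG hG; rewrite /top_ext sM // det_mulmx scalar_mxM.
  have topE A : (\det (rho A))%:M = (top_ext sigma A^T)^T.
    by rewrite /top_ext tr_scalar_mx det_tr.
  have [t [tb _]] := dual_basis HK0 HG top1 topM topE hB1.
  have [z2 [z2b _]] := dual_basis HK0 HG s1 sM rhoE hB2.
  exists k1, t, d1; split=> //; rewrite dd.
  exact: (winv_basis_degree_unique HK0 HW rho1 rhoM zb z2b).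
have [kt [tV [wtV tVb]]] : exists k (t : 'I_k -> 'rV[{mpoly K[r]}]_1) wt,
    winv_basis W (fun g => (\det (rhoV g))%:M : 'M_1) t wt.
  apply: (exists_winv_basis HK0 HW); first exact: (detrho1 rhoV1).
  by move=> g h gW hW; apply: (detrhoM rhoVM).
have dwV : (\sum_i mV i = \sum_i wtV i)%N.
  exact: (winv_basis_degree_det HK0 HW zVb tVb).
have serM y := eigen_series HK0 HG Hgamma_unit Hgamma_norm Hsigma rhoE HB y tb dw.
have serV y := eigen_series HK0 HG Hgamma_unit Hgamma_norm HsigmaV rhoVE HBV y tVb dwV.
set hat := twisted_hatdet W gamma^T in serM serV.
pose P := \prod_(i < m) (1 - 'X * (eps i *: 'X^(degs i))%:P) : {poly {poly K}}.
pose PV := \prod_(i < r) (1 - epsV i *: 'X^((mV i).+1)) : {poly K}.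
pose PVy := \prod_(i < r) (1 - 'X * (epsV i *: 'X^(mV i))%:P) : {poly {poly K}}.
pose Dx g : {poly K} := det1x (invmx (gamma^T *m g)).
have polyM := bivariate_series HK0 serM; have polyV := bivariate_series HK0 serV.
rewrite -/P in polyM; rewrite -/PVy in polyV.
pose D := \prod_(g <- W) Dx g.
have hatE g : g \in W -> Dx g * hat g = D by move=> gW; rewrite /D (big_rem g gW).
(* At y = x each summand for V becomes the common denominator [D], and the extra factor x turns the
   exponents m into the degrees m + 1. *)
have molien : (size W)%:R * D = PV * \sum_(g <- W) hat g.
  have := congr1 (horner^~ 'X) polyV; rewrite /= horner_sum hornerM hornerC.
  have -> : PVy.['X] = PV.
    rewrite horner_prod; apply: eq_bigr => i _.
    by rewrite !hornerE -scalerAr -exprS.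
  move=> <-; rewrite big_seq (eq_bigr (fun=> D)) => [|g gW]; last first.
    by rewrite hornerM hornerC det1y_X hatE.
  by rewrite -big_seq big_const_seq count_predT iter_addr_0 mulr_natl.
have D0 : D != 0 by rewrite prodf_seq_neq0; apply/allP => g _; apply: det1x_neq0.
have sW : (size W)%:R != 0 :> {poly K}.
  by rewrite -polyC_natr polyC_eq0 (refl_size_neq0 HK0 HW).
have [PV0 hat0] : PV != 0 /\ \sum_(g <- W) hat g != 0.
  by apply/andP; rewrite -negb_or -mulf_eq0 -molien mulf_neq0.
pose T (p : {poly K}) : {fraction {poly {poly K}}} := tofrac p%:P.
have T0 p : p != 0 -> T p != 0 by rewrite tofrac_eq0 polyC_eq0.
have dualE n (A : 'M[K]_n) : dualmx A = invmx A^T by rewrite /dualmx trmx_inv.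
(* The dual of sigma(g gamma) is the inverse of its transpose, that is of rho(gamma^T g^T): the sum
   over the coset of gamma becomes a sum over the transposed group. *)
have termE g : g \in G -> det1m yv (sigma (g *m gamma)) / det1m xv (g *m gamma) =
    tofrac (det1y (invmx (rho (gamma^T *m g^T))) * (hat g^T)%:P) / T D.
  move=> gG; have gW : g^T \in W by rewrite mem_trmx trmxK.
  rewrite det1m_y det1m_x !dualE trmx_mul rhoE trmx_mul !trmxK.
  rewrite -(hatE _ gW) /T polyCM !tofracM invfM mulrACA divff ?mulr1 //.
  by apply: T0; apply: contraNneq hat0 => h0; move: D0; rewrite -(hatE _ gW) h0 mulr0 eqxx.
rewrite big_seq (eq_bigr _ termE) -big_seq -mulr_suml -rmorph_sum /=.
have -> : \sum_(g <- G) det1y (invmx (rho (gamma^T *m g^T))) * (hat g^T)%:P =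
    \sum_(g <- W) det1y (invmx (rho (gamma^T *m g))) * (hat g)%:P by rewrite big_map.
have -> : \prod_(i < m) (1 - yv * kc (eps i) * xv ^+ degs i) = tofrac P.
  rewrite rmorph_prod; apply: eq_bigr => i _ /=.
  by rewrite tofracB tofrac1 tofracM -mul_polyC polyCM tofracM rmorphXn tofracXn mulrA.
have -> : \prod_(i < r) (1 - kc (epsV i) * xv ^+ (mV i).+1) = T PV.
  rewrite /T !rmorph_prod; apply: eq_bigr => i _ /=.
  by rewrite polyCB tofracB tofrac1 -mul_polyC polyCM tofracM rmorphXn tofracXn.
have molT : (size G)%:R * T D = T PV * T (\sum_(g <- W) hat g).
  rewrite -tofracM -polyCM -molien polyCM tofracM size_map.
  by congr (_ * _); rewrite -polyC_natr !rmorph_nat.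
rewrite polyM tofracM -mulrA mulrCA; congr (_ * _).
have sG : (size G)%:R != 0 :> {fraction {poly {poly K}}}.
  by rewrite -(rmorph_nat (@tofrac _)) tofrac_eq0 -polyC_natr polyC_eq0 -(size_map trmx).
apply: (mulfI (T0 _ PV0)); rewrite mulfV ?T0 // mulrCA [T PV * _]mulrA -molT.
by rewrite mulfK ?T0 // mulVf.
Qed.
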